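(* Let $(R,\mathfrak{m})$ be a commutative noetherian local ring, $I$ an ideal of $R$, $M$ an artinian $R$-module and $s$ a non-negative integer. Then the following statements are equivalent: (i) $\mathfrak{F}^I_i(M)$ is artinian for all $i>s$; (ii) $\mathfrak{F}^I_i(M)=0$ for all $i>s$; (iii) $\operatorname{Ass}(\mathfrak{F}^I_i(M))\subseteq\{\mathfrak m\}$ for all $i>s$.
   Context: For an $R$-module $N$, $H^{\mathfrak m}_i(N)=\varprojlim_s\operatorname{Tor}^R_i(R/\mathfrak m^s,N)$, and the $i$-th $I$-formal local homology module is $\mathfrak{F}^I_i(M)=\varinjlim_t H^{\mathfrak m}_i(0:_M I^t)$, where $0:_M I^t=\{x\in M:I^tx=0\}$ and the transition maps are induced by inclusions. $\operatorname{Ass}$ denotes the set of associated primes over $R$. *)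

(* Defs.v *)
From HB Require Import structures.
From mathcomp Require Import all_boot all_algebra.
From mathcomp Require Import boolp.
From mathcomp.multinomials Require Import freeg.

Set Implicit Arguments.
Unset Strict Implicit.
Unset Printing Implicit Defensive.

Import GRing.Theory.
Local Open Scope ring_scope.
Local Open Scope quotient_scope.

(* Ideals of R are the submodules of the regular module R^o. Submodules are   *)
(* boolean predicates; asbool from boolp (excluded middle and choice) turns   *)
(* arbitrary propositions into such predicates.                               *)

Section Submodules.
Variables (R : comNzRingType) (V : lmodType R).

Definition submod_pred (P : V -> Prop) : {pred V} := fun x => `[< P x >].

Definition is_submod (P : V -> Prop) : Prop :=
  P 0 /\ forall (a : R) u v, P u -> P v -> P (a *: u + v).

Lemma submod_pred_closed P : is_submod P -> submod_closed (submod_pred P).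
Proof.
case=> P0 Plin; split; first exact/asboolP.
by move=> a u v /asboolP Pu /asboolP Pv; apply/asboolP/Plin.
Qed.

Definition mk_submod P (hP : is_submod P) : submodClosed V :=
  HB.pack (submod_pred P)
    (GRing.isSubmodClosed.Build R V (submod_pred P)
      (GRing.submod_closed_semi (submod_pred_closed hP))).

Lemma mem_mk_submod P (hP : is_submod P) x : (x \in mk_submod hP) <-> P x.
Proof. by rewrite -[x \in _]/(`[< P x >]); split=> /asboolP. Qed.

Definition in_span (G : V -> Prop) (x : V) : Prop :=
  forall S : submodClosed V, (forall y, G y -> y \in S) -> x \in S.

Lemma in_span_submod G : is_submod (in_span G).
Proof.
split=> [S _|a u v Gu Gv S GS]; first exact: rpred0.
by rewrite rpredD ?rpredZ ?Gu ?Gv.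
Qed.

Definition span G : submodClosed V := mk_submod (in_span_submod G).

Lemma mem_span (G : V -> Prop) x : G x -> x \in span G.
Proof. by move=> Gx; apply/mem_mk_submod => S; apply. Qed.

Lemma span_sub (G : V -> Prop) (S : submodClosed V) :
  (forall y, G y -> y \in S) -> {subset span G <= S}.
Proof. by move=> GS x /mem_mk_submod; apply. Qed.

Definition noetherian : Prop :=
  forall N : nat -> submodClosed V,
    (forall n, {subset N n <= N n.+1}) ->
    exists k, forall n, (k <= n)%N -> N n =i N k.

Definition artinian : Prop :=
  forall N : nat -> submodClosed V,
    (forall n, {subset N n.+1 <= N n}) ->
    exists k, forall n, (k <= n)%N -> N n =i N k.

End Submodules.

Section SubType.
Variables (R : comNzRingType) (V : lmodType R) (S : submodClosed V).

Record submod : Type := Submod { submod_val : V; _ : submod_val \in S }.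

HB.instance Definition _ := [isSub for submod_val].
HB.instance Definition _ := [Choice of submod by <:].
HB.instance Definition _ :=
  GRing.SubChoice_isSubLmodule.Build R V (S : {pred V}) submod
    (GRing.subsemimodClosedP S).

Lemma submodP (x : submod) : submod_val x \in S. Proof. by case: x. Qed.

Lemma submod_val_linear : linear submod_val. Proof. by []. Qed.
HB.instance Definition _ :=
  GRing.isLinear.Build R submod V *:%R submod_val submod_val_linear.

End SubType.

Section SubMap.
Variables (R : comNzRingType) (U V : lmodType R).
Variables (S : submodClosed U) (T : submodClosed V) (f : {linear U -> V}).
Hypothesis fST : forall x, x \in S -> f x \in T.

Definition submap (x : submod S) : submod T := Submod (fST (submodP x)).

Lemma submap_linear : linear submap.
Proof. by move=> a x y; apply: val_inj; rewrite /= linearP. Qed.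
HB.instance Definition _ :=
  GRing.isLinear.Build R (submod S) (submod T) *:%R submap submap_linear.

End SubMap.
Arguments submap {R U V S T f} fST x.

Section QuotientModule.
Variables (R : comNzRingType) (V : lmodType R) (S : submodClosed V).

Definition zmod_of_submod : zmodClosed V :=
  HB.pack (GRing.SubmodClosed.sort S) (GRing.isZmodClosed.Build V (GRing.SubmodClosed.sort S)
    (GRing.subsemimod_closedB (GRing.subsemimodClosedP S))).

Definition quotmod : Type := Quotient.quot zmod_of_submod.
HB.instance Definition _ := GRing.Zmodule.on quotmod.

Definition qproj (x : V) : quotmod := \pi_(Quotient.quot zmod_of_submod) x.

Lemma qproj_eq x y : qproj x = qproj y <-> x - y \in S.
Proof.
rewrite /qproj; split=> [/eqP|h]; last apply/eqP; by rewrite -Quotient.idealrBE.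
Qed.

Definition qrepr (x : quotmod) : V := repr (x : Quotient.quot zmod_of_submod).

Lemma qreprK x : qproj (qrepr x) = x. Proof. exact: reprK. Qed.

Lemma qproj_reprB x : qrepr (qproj x) - x \in S.
Proof. by apply/qproj_eq; rewrite qreprK. Qed.

Lemma qprojD x y : qproj (x + y) = qproj x + qproj y.
Proof. exact: (@Quotient.pi_add V zmod_of_submod x y). Qed.

Definition qscale (a : R) (x : quotmod) : quotmod := qproj (a *: qrepr x).

Lemma qscaleE a x : qscale a (qproj x) = qproj (a *: x).
Proof. by apply/qproj_eq; rewrite -scalerBr rpredZ ?qproj_reprB. Qed.

Lemma qscaleA a b x : qscale a (qscale b x) = qscale (a * b) x.
Proof. by rewrite -[x]qreprK !qscaleE scalerA. Qed.
Lemma qscale1 x : qscale 1 x = x.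
Proof. by rewrite -[x]qreprK qscaleE scale1r. Qed.
Lemma qscaleDr a x y : qscale a (x + y) = qscale a x + qscale a y.
Proof.
by rewrite -[x]qreprK -[y]qreprK -qprojD !qscaleE scalerDr qprojD.
Qed.
Lemma qscaleDl x a b : qscale (a + b) x = qscale a x + qscale b x.
Proof. by rewrite -[x]qreprK !qscaleE scalerDl qprojD. Qed.

HB.instance Definition _ := GRing.Zmodule_isLmodule.Build R quotmod
  qscaleA qscale1 qscaleDr qscaleDl.

Lemma qproj_linear : linear qproj.
Proof. by move=> a x y; rewrite qprojD -qscaleE. Qed.
HB.instance Definition _ := GRing.isLinear.Build R V quotmod *:%R qproj qproj_linear.

End QuotientModule.

Section QuotMap.
Variables (R : comNzRingType) (U V : lmodType R).
Variables (S : submodClosed U) (T : submodClosed V) (f : {linear U -> V}).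
Hypothesis fST : forall x, x \in S -> f x \in T.

Definition quot_fun (x : quotmod S) : quotmod T := qproj T (f (qrepr x)).

Lemma quot_funE x : quot_fun (qproj S x) = qproj T (f x).
Proof. by apply/qproj_eq; rewrite -linearB fST // qproj_reprB. Qed.

Lemma quot_fun_linear : linear quot_fun.
Proof.
move=> a x y; rewrite -[x]qreprK -[y]qreprK -linearP !quot_funE.
by rewrite !linearP.
Qed.

Definition quotmap : {linear quotmod S -> quotmod T} :=
  HB.pack quot_fun (GRing.isLinear.Build R (quotmod S) (quotmod T) *:%R
    quot_fun quot_fun_linear).

Lemma quotmapE x : quotmap (qproj S x) = qproj T (f x).
Proof. exact: quot_funE. Qed.

End QuotMap.
Arguments quotmap {R U V S T f} fST.

Section FreeLift.
Variables (R : comNzRingType) (K : choiceType) (V : lmodType R) (f : K -> V).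

Lemma fglift_linear : linear (fglift f : {freeg K / R} -> V).
Proof.
pose g : {additive {freeg K / R} -> V} :=
  HB.pack (fglift f : {freeg K / R} -> V)
    (GRing.isZmodMorphism.Build _ _ (fglift f : {freeg K / R} -> V)
      (@lift_is_additive R K V f)).
move=> a x y; rewrite -[fglift f]/(g : _ -> _) raddfD; congr (_ + _).
have -> : g x = \sum_(k <- dom x) coeff k x *: f k.
  rewrite -{1}[x]freeg_sumE raddf_sum; apply: eq_bigr => k _.
  exact: liftU.
rewrite [a *: x]/(fgscale a x) /fgscale raddf_sum scaler_sumr.
by apply: eq_bigr => k _; rewrite scalerA; apply: liftU.
Qed.
HB.instance Definition _ :=
  GRing.isLinear.Build R {freeg K / R} V *:%R (fglift f) fglift_linear.

Lemma fglift1 k : fglift f << k >> = f k.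
Proof. by rewrite liftU scale1r. Qed.

End FreeLift.

Lemma freeg_ext (R : comNzRingType) (K : choiceType) (V : lmodType R)
    (f g : {linear {freeg K / R} -> V}) :
  (forall k, f << k >> = g << k >>) -> f =1 g.
Proof.
move=> fg x; rewrite -[x]freeg_sumE !linear_sum; apply: eq_bigr => k _.
suff -> : << coeff k x *g k >> = coeff k x *: << k >> :> {freeg K / R}.
  by rewrite !linearZ fg.
by apply/eqP/freeg_eqP => z; rewrite coeffZ !coeffU mul1r.
Qed.

Section FreeMap.
Variables (R : comNzRingType) (J K : choiceType) (f : J -> K).

Definition freemap : {freeg J / R} -> {freeg K / R} :=
  fglift (fun j => << f j >>).
HB.instance Definition _ := GRing.Linear.on freemap.

Lemma freemap1 j : freemap << j >> = << f j >>.
Proof. exact: fglift1. Qed.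

End FreeMap.
Arguments freemap R {J K} f _.

Section Tensor.
Variable R : comNzRingType.

Section Object.
Variables A B : lmodType R.

(* The generators are << (x, y) >>, whose class is tens x y.                  *)
Variant tensor_rel : {freeg (A * B)%type / R} -> Prop :=
| TensorL (a : R) x x' y :
    tensor_rel (<< (a *: x + x', y) >> - (a *: << (x, y) >> + << (x', y) >>))
| TensorR (a : R) x y y' :
    tensor_rel (<< (x, a *: y + y') >> - (a *: << (x, y) >> + << (x, y') >>)).

Definition tensor : lmodType R := quotmod (span tensor_rel).

Definition tens (x : A) (y : B) : tensor := qproj (span tensor_rel) << (x, y) >>.

End Object.

Section Map.
Variables (A A' B B' : lmodType R).
Variables (f : {linear A -> A'}) (g : {linear B -> B'}).

Definition tens_key (p : A * B) : A' * B' := (f p.1, g p.2).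

Lemma tensmap_subproof x :
  x \in span (@tensor_rel A B) ->
  freemap R tens_key x \in span (@tensor_rel A' B').
Proof.
move=> /mem_mk_submod xS.
pose P z := freemap R tens_key z \in span (@tensor_rel A' B').
have hP : is_submod P.
  by split=> [|a u v Pu Pv]; rewrite /P ?linear0 ?rpred0 // linearP rpredD ?rpredZ.
apply/(mem_mk_submod hP)/xS => y Gy; apply/mem_mk_submod; rewrite /P.
case: Gy => *; apply: mem_span; rewrite linearB linearP /= !freemap1 /tens_key /= linearP.
  exact: TensorL.
exact: TensorR.
Qed.

Definition tensmap : {linear tensor A B -> tensor A' B'} :=
  quotmap tensmap_subproof.

Lemma tensmapE x y : tensmap (tens x y) = tens (f x) (g y).
Proof. by rewrite /tensmap /tens quotmapE /= freemap1. Qed.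

End Map.

Lemma tensor_ext (A B C : lmodType R) (h k : {linear tensor A B -> C}) :
  (forall x y, h (tens x y) = k (tens x y)) -> h =1 k.
Proof.
move=> hk z; rewrite -[z]qreprK.
apply: (freeg_ext (f := h \o qproj _) (g := k \o qproj _)).
by move=> p; rewrite [p]surjective_pairing; exact: (hk p.1 p.2).
Qed.

Lemma tensmap_comp (A1 A2 A3 B1 B2 B3 : lmodType R)
    (f : {linear A1 -> A2}) (f' : {linear A2 -> A3})
    (g : {linear B1 -> B2}) (g' : {linear B2 -> B3}) z :
  tensmap f' g' (tensmap f g z) = tensmap (f' \o f) (g' \o g) z.
Proof.
apply: (tensor_ext (h := tensmap f' g' \o tensmap f g)) => x y.
by rewrite -[LHS]/(tensmap f' g' (tensmap f g (tens x y))) !tensmapE.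
Qed.

Lemma tensmap_eq (A A' B B' : lmodType R) (f f' : {linear A -> A'})
    (g g' : {linear B -> B'}) :
  f =1 f' -> g =1 g' -> tensmap f g =1 tensmap f' g'.
Proof.
by move=> ff gg; apply: tensor_ext => x y; rewrite !tensmapE ff gg.
Qed.

Lemma tens0l (A B : lmodType R) (y : B) : tens (0 : A) y = 0.
Proof.
rewrite /tens -(linear0 (qproj (span (@tensor_rel A B)))).
apply/qproj_eq; rewrite subr0.
have /mem_span := @TensorL A B (-1) 0 0 y.
by rewrite scaler0 addr0 scaleN1r addNr subr0.
Qed.

End Tensor.

Section Complexes.
Variable R : comNzRingType.

Record complex := Complex {
  chain :> nat -> lmodType R;
  bdry : forall n, {linear chain n.+1 -> chain n};
  bdryK : forall n x, bdry n (bdry n.+1 x) = 0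
}.

Section Homology.
Variables (C : complex) (n : nat).

Definition is_cycle (n : nat) : C n -> Prop :=
  if n is k.+1 return C n -> Prop then fun x => bdry C k x = 0
  else fun _ => True.

Lemma is_cycle_submod : is_submod (@is_cycle n).
Proof.
case: n => [|k] //=; split=> [|a u v hu hv]; first exact: linear0.
by rewrite linearP hu hv scaler0 addr0.
Qed.

Definition cycles : submodClosed (C n) := mk_submod is_cycle_submod.

Definition is_boundary (z : submod cycles) : Prop :=
  exists y, submod_val z = bdry C n y.

Lemma is_boundary_submod : is_submod is_boundary.
Proof.
split=> [|a u v [y hy] [w hw]]; first by exists 0; rewrite linear0.
by exists (a *: y + w); rewrite [RHS]linearP -hy -hw.
Qed.

Definition boundaries : submodClosed (submod cycles) :=
  mk_submod is_boundary_submod.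

Definition homology : lmodType R := quotmod boundaries.

End Homology.

Record chain_map (C D : complex) := ChainMap {
  cmap :> forall n, {linear C n -> D n};
  cmap_bdry : forall n x, cmap n (bdry C n x) = bdry D n (cmap n.+1 x)
}.

Section HomologyMap.
Variables (C D : complex) (f : chain_map C D) (n : nat).

Lemma cycles_map x : x \in cycles C n -> f n x \in cycles D n.
Proof.
move=> /mem_mk_submod hx; apply/mem_mk_submod; case: n x hx => //= k x hx.
by rewrite -cmap_bdry hx linear0.
Qed.

Lemma boundaries_map z :
  z \in boundaries C n -> submap cycles_map z \in boundaries D n.
Proof.
move=> /mem_mk_submod [y hy]; apply/mem_mk_submod; exists (f n.+1 y).
by rewrite /= hy cmap_bdry.
Qed.

Definition homology_map : {linear homology C n -> homology D n} :=
  quotmap boundaries_map.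

End HomologyMap.

Lemma homology_map_comp (C D E : complex) (f : chain_map C D)
    (g : chain_map D E) (h : chain_map C E) n :
  (forall n x, g n (f n x) = h n x) ->
  forall z, homology_map g n (homology_map f n z) = homology_map h n z.
Proof.
move=> gf z; rewrite -[z]qreprK; move: (qrepr z) => w.
transitivity (homology_map g n (qproj _ (submap (@cycles_map _ _ f n) w))).
  by congr (homology_map g n _); apply: quotmapE.
rewrite [LHS]quotmapE [RHS]quotmapE.
by congr (qproj _ _); apply: val_inj; apply: gf.
Qed.

End Complexes.

Section FreeResolution.
Variable R : comNzRingType.

(* The functorial free resolution ... -> R^(Z_2) -> R^(Z_1) -> R^(A) of A,    *)
(* where Z_0 = A and Z_(n+1) is the kernel of the augmentation R^(Z_n) -> Z_n *)
Definition aug (A : lmodType R) : {linear {freeg A / R} -> A} := fglift id.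

Lemma ker_submod (A B : lmodType R) (f : {linear A -> B}) :
  is_submod (fun x => f x = 0).
Proof.
split=> [|a u v hu hv]; first exact: linear0.
by rewrite linearP hu hv scaler0 addr0.
Qed.

Definition augker (A : lmodType R) : lmodType R :=
  submod (mk_submod (ker_submod (aug A))).

Fixpoint syzygy (n : nat) (A : lmodType R) : lmodType R :=
  if n is k.+1 then augker (syzygy k A) else A.

Definition res_bdry (A : lmodType R) n :
    {linear {freeg (syzygy n.+1 A) / R} -> {freeg (syzygy n A) / R}} :=
  @submod_val R _ _ \o aug (syzygy n.+1 A).

Lemma res_bdryK A n x : res_bdry A n (res_bdry A n.+1 x) = 0.
Proof.
rewrite /res_bdry /=; set z := aug _ x.
by have /mem_mk_submod -> := submodP z; rewrite linear0.
Qed.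

Definition resolution (A : lmodType R) : complex R := Complex (@res_bdryK A).

Section Map.
Variables A B : lmodType R.

Lemma aug_freemap (C D : lmodType R) (f : {linear C -> D}) x :
  aug D (freemap R f x) = f (aug C x).
Proof.
apply: (freeg_ext (f := aug D \o freemap R f) (g := f \o aug C)) => k.
by rewrite /comp /= freemap1 !fglift1.
Qed.

Lemma augker_map_subproof (C D : lmodType R) (f : {linear C -> D}) x :
  x \in mk_submod (ker_submod (aug C)) ->
  freemap R f x \in mk_submod (ker_submod (aug D)).
Proof.
move=> /mem_mk_submod hx; apply/mem_mk_submod.
by rewrite aug_freemap hx linear0.
Qed.

Definition augker_map (C D : lmodType R) (f : {linear C -> D}) :
    {linear augker C -> augker D} :=
  submap (augker_map_subproof f).

Fixpoint syzygy_map (f : {linear A -> B}) n :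
    {linear syzygy n A -> syzygy n B} :=
  if n is k.+1 return {linear syzygy n A -> syzygy n B}
  then augker_map (syzygy_map f k) else f.

Definition res_map (f : {linear A -> B}) n :
    {linear resolution A n -> resolution B n} :=
  freemap R (syzygy_map f n).

Lemma res_map_bdry (f : {linear A -> B}) n x :
  res_map f n (bdry (resolution A) n x) =
  bdry (resolution B) n (res_map f n.+1 x).
Proof. by rewrite /= /res_bdry /= aug_freemap. Qed.

End Map.
End FreeResolution.

Section Tor.
Variable R : comNzRingType.

Section Object.
Variables A B : lmodType R.

Definition tor_bdry n :
    {linear tensor (resolution A n.+1) B -> tensor (resolution A n) B} :=
  tensmap (bdry (resolution A) n) idfun.

Lemma tor_bdryK n x : tor_bdry n (tor_bdry n.+1 x) = 0.
Proof.
rewrite /tor_bdry tensmap_comp.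
apply: (tensor_ext (k := GRing.Linear.clone _ _ _ _ \0 _)) => a b.
by rewrite tensmapE /= [X in tens X _](@bdryK _ (resolution A) n a) tens0l.
Qed.

Definition tor_complex : complex R := Complex tor_bdryK.

(* Tor is computed by resolving the first argument; since the resolution is  *)
(* functorial, Tor_map is defined without choosing lifts.                     *)
Definition Tor (i : nat) : lmodType R := homology tor_complex i.

End Object.

Section Map.
Variables (A A' B B' : lmodType R).
Variables (f : {linear A -> A'}) (g : {linear B -> B'}).

Definition tor_cmap n : {linear tor_complex A B n -> tor_complex A' B' n} :=
  tensmap (res_map f n) g.

Lemma tor_cmap_bdry n x :
  tor_cmap n (bdry (tor_complex A B) n x) =
  bdry (tor_complex A' B') n (tor_cmap n.+1 x).
Proof.
rewrite -[bdry _ n x]/(tor_bdry A B n x) -[RHS]/(tor_bdry A' B' n _).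
rewrite /tor_bdry /tor_cmap !tensmap_comp; apply: tensmap_eq => // y.
exact: res_map_bdry.
Qed.

Definition Tor_map i : {linear Tor A B i -> Tor A' B' i} :=
  homology_map (ChainMap tor_cmap_bdry) i.

End Map.

Lemma Tor_map_swap (A A' B B' : lmodType R)
    (f : {linear A -> A'}) (g : {linear B -> B'}) i z :
  Tor_map f idfun i (Tor_map idfun g i z) =
  Tor_map idfun g i (Tor_map f idfun i z).
Proof.
have id_syz C n x : @syzygy_map R C C idfun n x = x.
  elim: n x => //= n IH x; apply: val_inj.
  rewrite -[LHS]/(freemap R (syzygy_map idfun n) (val x)).
  apply: (freeg_ext (f := freemap R (@syzygy_map R C C idfun n))
                    (g := idfun)) => k.
  by rewrite -[LHS]/(freemap _ _ _) freemap1 IH.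
have id_res C n x : @res_map R C C idfun n x = x.
  apply: (freeg_ext (f := @res_map R C C idfun n) (g := idfun)) => k.
  by rewrite -[LHS]/(freemap _ _ _) freemap1 id_syz.
pose fg := ChainMap (tor_cmap_bdry f g).
transitivity (homology_map fg i z); last apply/esym.
  apply: homology_map_comp => n x; apply: etrans (tensmap_comp _ _ _ _ _) _.
  by apply: tensmap_eq => y //=; rewrite id_res.
apply: homology_map_comp => n x; apply: etrans (tensmap_comp _ _ _ _ _) _.
by apply: tensmap_eq => y //=; rewrite id_res.
Qed.

End Tor.

Section Limits.
Variable R : comNzRingType.

Section Product.
Variable X : nat -> lmodType R.

Definition prodmod : Type := forall n, X n.
HB.instance Definition _ := Choice.on prodmod.

Definition prod_add (x y : prodmod) : prodmod := fun n => x n + y n.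
Definition prod_opp (x : prodmod) : prodmod := fun n => - x n.
Definition prod_zero : prodmod := fun n => 0.
Definition prod_scale (a : R) (x : prodmod) : prodmod := fun n => a *: x n.

Lemma prod_addA : associative prod_add.
Proof. by move=> x y z; apply: functional_extensionality_dep => n; apply: addrA. Qed.
Lemma prod_addC : commutative prod_add.
Proof. by move=> x y; apply: functional_extensionality_dep => n; apply: addrC. Qed.
Lemma prod_add0 : left_id prod_zero prod_add.
Proof. by move=> x; apply: functional_extensionality_dep => n; apply: add0r. Qed.
Lemma prod_addN : left_inverse prod_zero prod_opp prod_add.
Proof. by move=> x; apply: functional_extensionality_dep => n; apply: addNr. Qed.
HB.instance Definition _ :=
  GRing.isZmodule.Build prodmod prod_addA prod_addC prod_add0 prod_addN.

Lemma prod_scaleA a b x : prod_scale a (prod_scale b x) = prod_scale (a * b) x.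
Proof. by apply: functional_extensionality_dep => n; apply: scalerA. Qed.
Lemma prod_scale1 x : prod_scale 1 x = x.
Proof. by apply: functional_extensionality_dep => n; apply: scale1r. Qed.
Lemma prod_scaleDr a (x y : prodmod) :
  prod_scale a (x + y) = prod_scale a x + prod_scale a y.
Proof. by apply: functional_extensionality_dep => n; apply: scalerDr. Qed.
Lemma prod_scaleDl (x : prodmod) a b :
  prod_scale (a + b) x = prod_scale a x + prod_scale b x.
Proof. by apply: functional_extensionality_dep => n; apply: scalerDl. Qed.
HB.instance Definition _ := GRing.Zmodule_isLmodule.Build R prodmod
  prod_scaleA prod_scale1 prod_scaleDr prod_scaleDl.

End Product.

Section ProductMap.
Variables (X Y : nat -> lmodType R) (h : forall n, {linear X n -> Y n}).

Definition prodmod_map (x : prodmod X) : prodmod Y := fun n => h n (x n).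

Lemma prodmod_map_linear : linear prodmod_map.
Proof. by move=> a x y; apply: functional_extensionality_dep => n; apply: linearP. Qed.
HB.instance Definition _ := GRing.isLinear.Build R (prodmod X) (prodmod Y) *:%R
  prodmod_map prodmod_map_linear.

End ProductMap.

Record inv_system := InvSystem {
  inv_obj :> nat -> lmodType R;
  inv_step : forall n, {linear inv_obj n.+1 -> inv_obj n}
}.

Definition is_thread (X : inv_system) (x : prodmod X) : Prop :=
  forall n, inv_step X n (x n.+1) = x n.

Lemma is_thread_submod (X : inv_system) : is_submod (@is_thread X).
Proof.
split=> [n|a u v hu hv n]; first exact: linear0.
by rewrite -[LHS]/(inv_step X n (a *: u n.+1 + v n.+1)) linearP hu hv.
Qed.

Definition threads (X : inv_system) : submodClosed (prodmod X) := mk_submod (@is_thread_submod X).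

Definition inv_lim (X : inv_system) : lmodType R := submod (threads X).

Section InvLimMap.
Variables (X Y : inv_system) (h : forall n, {linear X n -> Y n}).
Hypothesis h_step : forall n x, h n (inv_step X n x) = inv_step Y n (h n.+1 x).

Lemma threads_map x : x \in threads X -> prodmod_map h x \in threads Y.
Proof.
move=> /mem_mk_submod hx; apply/mem_mk_submod => n.
by rewrite /prodmod_map -h_step hx.
Qed.

Definition inv_lim_map : {linear inv_lim X -> inv_lim Y} := submap threads_map.

End InvLimMap.

Record dir_system := DirSystem {
  dir_obj :> nat -> lmodType R;
  dir_step : forall n, {linear dir_obj n -> dir_obj n.+1}
}.

Definition has_finite_support (X : nat -> lmodType R) (x : prodmod X) : Prop :=
  exists k, forall n, (k <= n)%N -> x n = 0.

Lemma has_finite_support_submod (X : nat -> lmodType R) : is_submod (@has_finite_support X).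
Proof.
split=> [|a u v [k hk] [l hl]]; first by exists 0%N.
exists (maxn k l) => n; rewrite geq_max => /andP[kn ln].
by rewrite -[LHS]/(a *: u n + v n) hk // hl // scaler0 addr0.
Qed.

Definition direct_sum (X : nat -> lmodType R) : lmodType R :=
  submod (mk_submod (@has_finite_support_submod X)).

Definition component (X : nat -> lmodType R) n (x : X n) : prodmod X :=
  dfwith (fun k => 0 : X k) x.

(* The direct limit is the direct sum modulo the submodule generated by the   *)
(* elements x - f x, for x in the n-th module and f the n-th transition map.  *)
Definition dir_rel (X : dir_system) (z : direct_sum X) : Prop :=
  exists n (x : X n),
    submod_val z = component x - component (dir_step X n x).

Definition dir_lim (X : dir_system) : lmodType R :=
  quotmod (span (@dir_rel X)).

End Limits.

Section Ideals.
Variable R : comNzRingType.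
Implicit Types I J p : submodClosed R^o.

Definition maximal_ideal J : Prop :=
  1 \notin J /\
  forall J' : submodClosed R^o, 1 \notin J' -> {subset J <= J'} -> J' =i J.

Definition local_ring (m : submodClosed R^o) : Prop :=
  maximal_ideal m /\ forall J, maximal_ideal J -> J =i m.

Definition prime_ideal p : Prop := 1 \notin p /\ prime_idealr_closed p.

(* p is an associated prime of N.                                             *)
Definition ass (N : lmodType R) p : Prop :=
  prime_ideal p /\ exists x : N, forall a : R, a \in p <-> a *: x = 0.

Definition unit_ideal : submodClosed R^o :=
  mk_submod (conj I (fun _ _ _ _ _ => I) : is_submod (fun _ : R^o => True)).

Definition ideal_mul I J : submodClosed R^o :=
  span (fun c : R^o => exists a b : R, [/\ a \in I, b \in J & c = a * b]).

Fixpoint ideal_exp J (n : nat) : submodClosed R^o :=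
  if n is k.+1 then ideal_mul J (ideal_exp J k) else unit_ideal.

Lemma ideal_exp_decr J n : {subset ideal_exp J n.+1 <= ideal_exp J n}.
Proof.
apply: span_sub => _ [a [b [_ bJ ->]]].
exact: (@rpredZ R R^o (ideal_exp J n) a b bJ).
Qed.

Section Annihilated.
Variables (M : lmodType R) (J : submodClosed R^o).

Definition killed_by (x : M) : Prop := forall a : R, a \in J -> a *: x = 0.

Lemma killed_by_submod : is_submod killed_by.
Proof.
split=> [a _|b u v hu hv a aJ]; first exact: scaler0.
by rewrite scalerDr scalerA mulrC -scalerA hu ?hv // scaler0 addr0.
Qed.

(* 0 :_M J *)
Definition ann_sub : submodClosed M := mk_submod killed_by_submod.

End Annihilated.

Lemma ann_sub_incr (M : lmodType R) J n x :
  x \in ann_sub M (ideal_exp J n) ->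
  (idfun : {linear M -> M}) x \in ann_sub M (ideal_exp J n.+1).
Proof.
move=> /mem_mk_submod hx; apply/mem_mk_submod => a aJ.
exact/hx/ideal_exp_decr.
Qed.

End Ideals.

Section LocalHomology.
Variables (R : comNzRingType) (m : submodClosed R^o).

Lemma ideal_exp_decr_subproof n x :
  x \in ideal_exp m n.+1 -> (idfun : {linear R^o -> R^o}) x \in ideal_exp m n.
Proof. exact: ideal_exp_decr. Qed.

Definition quot_exp (n : nat) : lmodType R := quotmod (ideal_exp m n).

Definition quot_exp_step n : {linear quot_exp n.+1 -> quot_exp n} :=
  quotmap (@ideal_exp_decr_subproof n).

Definition tor_system (i : nat) (N : lmodType R) : inv_system R :=
  @InvSystem R (fun n => Tor (quot_exp n) N i)
    (fun n => Tor_map (quot_exp_step n) idfun i).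

(* H^m_i(N) = lim_n Tor_i(R/m^n, N)                                           *)
Definition local_homology (i : nat) (N : lmodType R) : lmodType R :=
  inv_lim (tor_system i N).

Section Map.
Variables (i : nat) (N N' : lmodType R) (g : {linear N -> N'}).

Lemma tor_system_map n x :
  Tor_map idfun g i (inv_step (tor_system i N) n x) =
  inv_step (tor_system i N') n (Tor_map idfun g i x).
Proof. exact/esym/Tor_map_swap. Qed.

Definition local_homology_map : {linear local_homology i N -> local_homology i N'} :=
  @inv_lim_map R (tor_system i N) (tor_system i N') (fun=> Tor_map idfun g i)
    tor_system_map.

End Map.

Variables (I : submodClosed R^o) (i : nat) (M : lmodType R).

Definition formal_system : dir_system R :=
  @DirSystem R (fun t => local_homology i (submod (ann_sub M (ideal_exp I t))))
    (fun t => local_homology_map i (submap (@ann_sub_incr R M I t))).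

(* colim_t H^m_i(0 :_M I^t)                                                   *)
Definition formal_local_homology : lmodType R := dir_lim formal_system.

End LocalHomology.

(* Main.v *)
Require Import Defs.
From mathcomp Require Import all_boot all_algebra.
From HB Require Import structures.
From mathcomp Require Import boolp.
From mathcomp Require classical_sets.
From mathcomp.multinomials Require Import freeg.

(* Only (iii) => (ii) is substantial. An associated-prime argument turns (iii)
   into: every element of F_i(M), i > s, is killed by a power of each a in m.
   One inducts on the artinian module M. Some submodule T of M has M/T of finite
   length and x T = T for some x in m (M is a sum of irreducible submodules, and
   x comes from prime avoidance). Finite length modules have no local homology
   in positive degrees (Artin-Rees), so F_i(T) = F_i(M) for i > 0, and T may
   replace M. If x M = M, let L = 0 :_M x. The sequences
     0 -> 0 :_L I^t -> 0 :_M I^t -> x (0 :_M I^t) -> 0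
   become, in the limit, a long exact sequence
     F_{i+1}(M) -> F_i(L) -> F_i(M) -> F_i(M)
   whose last map is multiplication by x, because each 0 :_M I^t lies in some
   x (0 :_M I^t') (a dual Artin-Rees lemma). Hence F_i(L) is torsion, so zero by
   induction; x is then injective on the torsion module F_i(M), which vanishes. *)

Set Implicit Arguments.
Unset Strict Implicit.
Unset Printing Implicit Defensive.

Import GRing.Theory.
Local Open Scope ring_scope.

(** * Linear maps, submodules and chain conditions *)

(** The condition on associated primes does not travel along exact sequences: a quotient of
    F_{i+1}(M) may acquire new associated primes. Torsion with respect to each element of m does
    pass to submodules, quotients and extensions, and F_i(L) contains a quotient of F_{i+1}(M) with
    remaining quotient inside F_i(M). Since degree i for L thus consumes degrees i and i+1 for M,
    all degrees above s are treated at once. Exactness must survive the inverse limits that define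
    local homology. It does by a Mittag-Leffler argument, because Tor_i(R/m^n, N) is artinian for
    artinian N; this is itself proved by induction along the same T and L, since the functorial
    resolution need not have finite rank. The direct limit enters only through representatives: a
    class at stage t is zero when some inclusion into a later stage kills it. Maps between submodule
    types are characterised by their values in an ambient module, and diagrams are checked there. *)

Section LinearMaps.
Variable R : comNzRingType.
Implicit Types U V W : lmodType R.

Lemma submodB V (S : submodClosed V) x y : x \in S -> y \in S -> x - y \in S.
Proof. by move=> xS yS; rewrite -scaleN1r rpredD ?rpredZ. Qed.

(** A total relation closed under linear combinations is single-valued as soon as 0 is related only
    to 0, so a choice function for it is linear. Maps without a direct formula, such as connecting
    homomorphisms, are obtained this way. *)
Lemma linear_of_relation U V (D : U -> V -> Prop) :
  (forall x, exists y, D x y) -> (forall y, D 0 y -> y = 0) ->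
  (forall a x y u v, D x u -> D y v -> D (a *: x + y) (a *: u + v)) ->
  exists f : {linear U -> V}, forall x, D x (f x).
Proof.
move=> /choice [f Df] D0 Dlin.
have flin : linear f.
  move=> a x y; apply/esym/eqP; rewrite -subr_eq0; apply/eqP/D0.
  have := Dlin (-1) _ _ _ _ (Df (a *: x + y)) (Dlin a _ _ _ _ (Df x) (Df y)).
  by rewrite !scaleN1r addNr [- _ + _]addrC.
pose g : {linear U -> V} := HB.pack f (GRing.isLinear.Build R U V *:%R f flin).
by exists g.
Qed.

(** Replaces coercions between nested submodule types: source and target are compared inside a
    common ambient module. *)
Lemma linear_factor U V W (a : {linear U -> W}) (b : {linear V -> W}) :
  injective b -> (forall x, exists y, b y = a x) ->
  exists j : {linear U -> V}, forall x, b (j x) = a x.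
Proof.
move=> b_inj ab.
have [|y|c x y u v /= hu hv|j jP] := @linear_of_relation U V (fun x y => b y = a x).
- exact: ab.
- by rewrite linear0 => by0; apply: b_inj; rewrite linear0.
- by rewrite !linearP hu hv.
by exists j.
Qed.

Lemma linear_inj U V (f : {linear U -> V}) :
  (forall x, f x = 0 -> x = 0) -> injective f.
Proof.
move=> f0 x y fxy; apply/eqP; rewrite -subr_eq0; apply/eqP/f0.
by rewrite linearB fxy subrr.
Qed.

Lemma submod_val_inj V (S : submodClosed V) : injective (@submod_val R V S).
Proof. exact: val_inj. Qed.

Lemma scalemap_linear V (a : R) : linear ( *:%R a : V -> V).
Proof. by move=> b u v; rewrite scalerDr !scalerA mulrC. Qed.
Definition scalemap V (a : R) : {linear V -> V} :=
  HB.pack ( *:%R a : V -> V) (GRing.isLinear.Build R V V *:%R ( *:%R a)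
    (scalemap_linear a)).

Lemma scalemapE V a (x : V) : scalemap V a x = a *: x. Proof. by []. Qed.

Lemma is_submod_preim U V (f : {linear U -> V}) (S : submodClosed V) :
  is_submod (fun x => f x \in S).
Proof. by split=> [|a u v hu hv]; rewrite ?linear0 ?rpred0 // linearP rpredD ?rpredZ. Qed.
Definition preim_submod U V (f : {linear U -> V}) S := mk_submod (is_submod_preim f S).

Lemma mem_preim U V (f : {linear U -> V}) S x : (x \in preim_submod f S) = (f x \in S).
Proof. by apply/idP/idP => h; apply/(mem_mk_submod (is_submod_preim f S)). Qed.

Lemma is_submod_im U V (f : {linear U -> V}) (S : submodClosed U) :
  is_submod (fun y => exists2 x, x \in S & f x = y).
Proof.
split=> [|a _ _ [x xS <-] [y yS <-]]; first by exists 0; rewrite ?rpred0 ?linear0.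
by exists (a *: x + y); rewrite ?linearP // rpredD ?rpredZ.
Qed.
Definition im_submod U V (f : {linear U -> V}) S := mk_submod (is_submod_im f S).

Lemma mem_im U V (f : {linear U -> V}) S y :
  y \in im_submod f S <-> exists2 x, x \in S & f x = y.
Proof. exact: mem_mk_submod. Qed.

Lemma is_submod_range U V (f : {linear U -> V}) : is_submod (fun y => exists x, f x = y).
Proof.
split=> [|a _ _ [x <-] [y <-]]; first by exists 0; rewrite linear0.
by exists (a *: x + y); rewrite linearP.
Qed.
Definition range U V (f : {linear U -> V}) := mk_submod (is_submod_range f).

Lemma mem_range U V (f : {linear U -> V}) y : y \in range f <-> exists x, f x = y.
Proof. exact: mem_mk_submod. Qed.

Lemma to_range U V (f : {linear U -> V}) :
  exists g : {linear U -> submod (range f)}, forall x, submod_val (g x) = f x.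
Proof.
have [//| |g gP] := @linear_factor U (submod (range f)) V f (@submod_val R V (range f)).
- exact: submod_val_inj.
- move=> x; have xf : f x \in range f by apply/mem_range; exists x.
  by exists (Submod xf).
by exists g.
Qed.

Lemma is_submod_add V (S T : submodClosed V) :
  is_submod (fun x => exists u v, [/\ u \in S, v \in T & x = u + v]).
Proof.
split=> [|a _ _ [u [v [uS vT ->]]] [u' [v' [u'S v'T ->]]]].
  by exists 0, 0; rewrite !rpred0 addr0.
exists (a *: u + u'), (a *: v + v'); rewrite !rpredD ?rpredZ //; split=> //.
by rewrite scalerDr addrACA.
Qed.
Definition add_submod V (S T : submodClosed V) := mk_submod (is_submod_add S T).

Lemma mem_add V (S T : submodClosed V) x :
  x \in add_submod S T <-> exists u v, [/\ u \in S, v \in T & x = u + v].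
Proof. exact: mem_mk_submod. Qed.

Lemma sub_addl V (S T : submodClosed V) : {subset S <= add_submod S T}.
Proof. by move=> x xS; apply/mem_add; exists x, 0; rewrite rpred0 addr0. Qed.

Lemma sub_addr V (S T : submodClosed V) : {subset T <= add_submod S T}.
Proof. by move=> x xS; apply/mem_add; exists 0, x; rewrite rpred0 add0r. Qed.

Lemma is_submod0 V : is_submod (fun x : V => x = 0).
Proof. by split=> // a u v -> ->; rewrite scaler0 addr0. Qed.
Definition zero_submod V := mk_submod (is_submod0 V).
Lemma mem_zero V (x : V) : x \in zero_submod V <-> x = 0.
Proof. exact: mem_mk_submod. Qed.

Definition full_submod V : submodClosed V :=
  mk_submod (conj I (fun _ _ _ _ _ => I) : is_submod (fun _ : V => True)).
Lemma mem_full V (x : V) : x \in full_submod V.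
Proof. exact/mem_mk_submod. Qed.

Lemma is_submod_cyclic V (y : V) : is_submod (fun x => exists a : R, x = a *: y).
Proof.
split=> [|a _ _ [b ->] [c ->]]; first by exists 0; rewrite scale0r.
by exists (a * b + c); rewrite scalerDl scalerA.
Qed.
Definition cyclic_submod V (y : V) := mk_submod (is_submod_cyclic y).
Lemma mem_cyclic V (x y : V) : x \in cyclic_submod y <-> exists a : R, x = a *: y.
Proof. exact: mem_mk_submod. Qed.
Lemma cyclic_id V (y : V) : y \in cyclic_submod y.
Proof. by apply/mem_cyclic; exists 1; rewrite scale1r. Qed.

Lemma is_submod_cap V (S T : submodClosed V) : is_submod (fun x => x \in S /\ x \in T).
Proof.
by split=> [|a u v [uS uT] [vS vT]]; rewrite ?rpred0 //; split; rewrite rpredD ?rpredZ.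
Qed.
Definition cap_submod V (S T : submodClosed V) := mk_submod (is_submod_cap S T).
Lemma mem_cap V (S T : submodClosed V) x : x \in cap_submod S T <-> x \in S /\ x \in T.
Proof. exact: mem_mk_submod. Qed.

Definition smul (J : submodClosed R^o) V : submodClosed V :=
  Defs.span (fun v : V => exists (a : R) u, a \in J /\ v = a *: u).

Lemma mem_smul (J : submodClosed R^o) V (a : R) (v : V) : a \in J -> a *: v \in smul J V.
Proof. by move=> aJ; apply: mem_span; exists a, v. Qed.

Lemma smul_sub (J : submodClosed R^o) V (S : submodClosed V) :
  (forall (a : R) v, a \in J -> a *: v \in S) -> {subset smul J V <= S}.
Proof. by move=> h; apply: span_sub => _ [a [u [aJ ->]]]; apply: h. Qed.

End LinearMaps.

Section ChainConditions.
Variable R : comNzRingType.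
Implicit Types U V W : lmodType R.

Lemma noetherian_max V (P : submodClosed V -> Prop) S0 : noetherian V -> P S0 ->
  exists S, P S /\ forall T, P T -> {subset S <= T} -> {subset T <= S}.
Proof.
move=> nV PS0; apply: contrapT => noS.
have step (S : {S | P S}) : exists T : {S | P S},
    {subset sval S <= sval T} /\ ~ {subset sval T <= sval S}.
  case: S => S PS /=; apply: contrapT => h; apply: noS; exists S; split=> // T PT ST.
  by apply: contrapT => TS; apply: h; exists (exist _ T PT).
have [next nextP] := choice step.
pose N n := sval (iter n next (exist _ S0 PS0)).
have [n|k hk] := nV N; first by have [] := nextP (iter n next (exist _ S0 PS0)).
have [_] := nextP (iter k next (exist _ S0 PS0)); case=> x.
by rewrite -[sval _]/(N k.+1) hk.
Qed.

Lemma artinian_min V (P : submodClosed V -> Prop) S0 : artinian V -> P S0 ->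
  exists S, P S /\ forall T, P T -> {subset T <= S} -> {subset S <= T}.
Proof.
move=> nV PS0; apply: contrapT => noS.
have step (S : {S | P S}) : exists T : {S | P S},
    {subset sval T <= sval S} /\ ~ {subset sval S <= sval T}.
  case: S => S PS /=; apply: contrapT => h; apply: noS; exists S; split=> // T PT ST.
  by apply: contrapT => TS; apply: h; exists (exist _ T PT).
have [next nextP] := choice step.
pose N n := sval (iter n next (exist _ S0 PS0)).
have [n|k hk] := nV N; first by have [] := nextP (iter n next (exist _ S0 PS0)).
have [_] := nextP (iter k next (exist _ S0 PS0)); case=> x.
by rewrite -[sval (next _)]/(N k.+1) hk.
Qed.

Section Exact.
Variables (U V W : lmodType R) (f : {linear U -> V}) (g : {linear V -> W}).
Hypothesis fg : forall y, g y = 0 -> exists x, f x = y.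

(** Two nested submodules of V with the same preimage in U and the same image in W coincide, so a
    chain stops once both traces do. Exactness at V is the form in which a long exact sequence
    supplies the data. *)
Lemma artinian_exact : artinian U -> artinian W -> artinian V.
Proof.
move=> aU aW N decN.
have [n x|k hk] := aU (fun n => preim_submod f (N n)).
  by rewrite !mem_preim; apply: decN.
have [n x|l hl] := aW (fun n => im_submod g (N n)).
  by move=> /mem_im [y yN <-]; apply/mem_im; exists y => //; apply: decN.
have decN' d n : {subset N (d + n)%N <= N n}.
  by elim: d => // d IH x /decN /IH.
exists (maxn k l) => n; rewrite geq_max => /andP[kn ln] y; apply/idP/idP.
  by move=> yn; apply: (decN' (n - maxn k l)%N); rewrite subnK // geq_max kn.
move=> yN.
have /mem_im [z zN gz] : g y \in im_submod g (N n).
  rewrite hl // -(hl (maxn k l)) ?leq_maxr //; apply/mem_im; by exists y.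
have [|x fx] := fg (y := y - z); first by rewrite linearB gz subrr.
have zN' : z \in N (maxn k l).
  by apply: (decN' (n - maxn k l)%N); rewrite subnK // geq_max kn.
have : x \in preim_submod f (N (maxn k l)) by rewrite mem_preim fx submodB.
rewrite hk ?leq_maxl // -(hk n) // mem_preim fx => yz.
by rewrite -(subrK z y) rpredD.
Qed.

Lemma noetherian_exact : noetherian U -> noetherian W -> noetherian V.
Proof.
move=> aU aW N incN.
have [n x|k hk] := aU (fun n => preim_submod f (N n)).
  by rewrite !mem_preim; apply: incN.
have [n x|l hl] := aW (fun n => im_submod g (N n)).
  by move=> /mem_im [y yN <-]; apply/mem_im; exists y => //; apply: incN.
have incN' d n : {subset N n <= N (d + n)%N}.
  by elim: d => // d IH x /IH /incN.
exists (maxn k l) => n; rewrite geq_max => /andP[kn ln] y; apply/idP/idP; last first.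
  by move=> /(incN' (n - maxn k l)%N); rewrite subnK // geq_max kn.
move=> yN.
have /mem_im [z zN gz] : g y \in im_submod g (N (maxn k l)).
  rewrite hl ?leq_maxr // -(hl n) //; apply/mem_im; by exists y.
have [|x fx] := fg (y := y - z); first by rewrite linearB gz subrr.
have zN' : z \in N n.
  by move: zN => /(incN' (n - maxn k l)%N); rewrite subnK // geq_max kn.
have : x \in preim_submod f (N n) by rewrite mem_preim fx submodB.
rewrite hk // -(hk (maxn k l)) ?leq_maxl // mem_preim fx => yz.
by rewrite -(subrK z y) rpredD.
Qed.

End Exact.

Lemma artinian_trivial V : (forall x : V, x = 0) -> artinian V.
Proof. by move=> h N _; exists 0%N => n _ x; rewrite (h x) !rpred0. Qed.

Lemma noetherian_trivial V : (forall x : V, x = 0) -> noetherian V.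
Proof. by move=> h N _; exists 0%N => n _ x; rewrite (h x) !rpred0. Qed.

Lemma zero_submodP V (x : submod (zero_submod V)) : x = 0.
Proof. by apply: val_inj; apply/mem_zero/submodP. Qed.

Let ezero U V : {linear U -> V} := GRing.Linear.clone _ _ _ _ \0 _.

Lemma artinian_inj U V (f : {linear U -> V}) : injective f -> artinian V -> artinian U.
Proof.
move=> f_inj; apply: (@artinian_exact (submod (zero_submod V)) _ _ (@ezero _ _) f).
  by move=> y fy; exists 0; apply: f_inj; rewrite fy !linear0.
exact/artinian_trivial/zero_submodP.
Qed.

Lemma noetherian_inj U V (f : {linear U -> V}) : injective f -> noetherian V -> noetherian U.
Proof.
move=> f_inj; apply: (@noetherian_exact (submod (zero_submod V)) _ _ (@ezero _ _) f).
  by move=> y fy; exists 0; apply: f_inj; rewrite fy !linear0.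
exact/noetherian_trivial/zero_submodP.
Qed.

Lemma artinian_surj U V (f : {linear U -> V}) :
  (forall y, exists x, f x = y) -> artinian U -> artinian V.
Proof.
move=> f_surj aU.
apply: (@artinian_exact _ _ (submod (zero_submod V)) f (@ezero _ _)) => //.
exact/artinian_trivial/zero_submodP.
Qed.

Lemma noetherian_surj U V (f : {linear U -> V}) :
  (forall y, exists x, f x = y) -> noetherian U -> noetherian V.
Proof.
move=> f_surj aU.
apply: (@noetherian_exact _ _ (submod (zero_submod V)) f (@ezero _ _)) => //.
exact/noetherian_trivial/zero_submodP.
Qed.

Lemma artinian_submod V (S : submodClosed V) : artinian V -> artinian (submod S).
Proof. exact: artinian_inj (@submod_val_inj _ _ _). Qed.

Lemma noetherian_submod V (S : submodClosed V) : noetherian V -> noetherian (submod S).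
Proof. exact: noetherian_inj (@submod_val_inj _ _ _). Qed.

Lemma qproj_surj V (S : submodClosed V) y : exists x, qproj S x = y.
Proof. by exists (qrepr y); rewrite qreprK. Qed.

Lemma qproj_eq0 V (S : submodClosed V) x : qproj S x = 0 <-> x \in S.
Proof. by rewrite -(linear0 (qproj S)) qproj_eq subr0. Qed.

Lemma noetherian_prod U V : noetherian U -> noetherian V -> noetherian (U * V)%type.
Proof.
move=> nU nV.
have linl : linear (fun x : U => (x, 0 : V)).
  by move=> a x y; congr pair; rewrite /= scaler0 addr0.
pose f : {linear U -> (U * V)%type} :=
  HB.pack (fun x : U => (x, 0 : V)) (GRing.isLinear.Build R U (U * V)%type *:%R _ linl).
pose g : {linear (U * V)%type -> V} := snd.
apply: (@noetherian_exact _ _ _ f g) => //.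
by move=> [x y] /= ->; exists x.
Qed.

Lemma pair_sum_linear U V W (f : {linear U -> W}) (g : {linear V -> W}) :
  exists h : {linear (U * V)%type -> W}, forall x y, h (x, y) = f x + g y.
Proof.
pose h (p : U * V) := f p.1 + g p.2.
have hl : linear h.
  by move=> a [x y] [x' y']; rewrite /h /= !linearP scalerDr addrACA.
pose h' : {linear (U * V)%type -> W} :=
  HB.pack h (GRing.isLinear.Build R (U * V)%type W *:%R h hl).
by exists h'.
Qed.

Definition gen V (xs : seq V) : submodClosed V := Defs.span (fun y => y \in xs).

Lemma noetherian_gen V : noetherian V -> exists xs, forall v : V, v \in gen xs.
Proof.
move=> nV.
have [|S [[xs Sxs] Smax]] :=
  @noetherian_max V (fun S => exists xs, S =i gen xs) (gen [::]) nV; first by exists [::].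
exists xs => v; rewrite -Sxs.
apply: (Smax (gen (v :: xs))); first by exists (v :: xs).
  move=> x; rewrite Sxs; apply: span_sub => y yxs.
  by apply: mem_span; rewrite inE yxs orbT.
by apply: mem_span; rewrite inE eqxx.
Qed.

Lemma cyclic_linear V (v : V) : exists f : {linear R^o -> V}, forall a, f a = (a : R) *: v.
Proof.
have hl : linear (fun a : R^o => (a : R) *: v).
  by move=> a x y; rewrite scalerDl scalerA.
pose h : {linear R^o -> V} := HB.pack (fun a : R^o => (a : R) *: v)
  (GRing.isLinear.Build R R^o V *:%R _ hl).
by exists h.
Qed.

(** Induction on the generators: [gen (x :: xs)] is the image of R x [gen xs] under (a, y) -> a x +
    y. *)
Lemma noetherian_of_gen V (xs : seq V) :
  noetherian R^o -> (forall v, v \in gen xs) -> noetherian V.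
Proof.
move=> nR genV; suff: noetherian (submod (gen xs)).
  by apply: (@noetherian_surj _ _ (@submod_val R V _)) => y; exists (Submod (genV y)).
elim: xs {genV} => [|x xs IH].
  apply: noetherian_trivial => y; apply: val_inj; apply/mem_zero.
  by move: (submodP y); apply: span_sub => z.
have [f fE] := cyclic_linear x.
have [h hE] := pair_sum_linear f (@submod_val R V (gen xs)).
have [|p|j jE] := @linear_factor _ _ (submod (gen (x :: xs))) _ h (@submod_val R V _).
- exact: submod_val_inj.
- have hp : h p \in gen (x :: xs).
    case: p => a y; rewrite hE fE rpredD ?rpredZ //.
      by apply: mem_span; rewrite inE eqxx.
    move: (submodP y); apply: span_sub => z zxs.
    by apply: mem_span; rewrite inE zxs orbT.
  by exists (Submod hp).
apply: (@noetherian_surj _ _ j) (noetherian_prod nR IH) => y.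
have : submod_val y \in range h.
  move: (submodP y); apply: span_sub => z; rewrite inE => /orP[/eqP ->|zxs].
    by apply/mem_range; exists (1, 0); rewrite hE fE scale1r linear0 addr0.
  by apply/mem_range; exists (0, Submod (mem_span zxs)); rewrite hE linear0 add0r.
by move=> /mem_range [p hp]; exists p; apply: val_inj; rewrite [LHS]jE.
Qed.

Lemma freeg_gen (K : choiceType) (S : submodClosed {freeg K / R}) x :
  (forall k, << k >> \in S) -> x \in S.
Proof.
move=> h; rewrite -[x]freeg_sumE rpred_sum // => k _.
suff -> : << coeff k x *g k >> = coeff k x *: << k >> :> {freeg K / R}.
  exact: rpredZ.
by apply/eqP/freeg_eqP => z; rewrite coeffZ !coeffU mul1r.
Qed.

Lemma noetherian_freeg n : noetherian R^o -> noetherian {freeg 'I_n / R}.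
Proof.
move=> nR; apply: (@noetherian_of_gen _ [seq << i >> | i <- enum 'I_n]) => // v.
by apply: freeg_gen => i; apply: mem_span; apply: map_f; rewrite mem_enum.
Qed.

Lemma noetherian_cover V : noetherian V ->
  exists n (f : {linear {freeg 'I_n / R} -> V}), forall y, exists x, f x = y.
Proof.
move=> /noetherian_gen [xs genV].
exists (size xs), (fglift (fun i : 'I_(size xs) => nth 0 xs i)) => y; apply/mem_range.
move: (genV y); apply: span_sub => z /(nthP 0) [i ixs <-].
apply/mem_range; exists << Ordinal ixs >>; exact: fglift1.
Qed.

End ChainConditions.

(** * Powers of ideals and Artin-Rees lemmas *)

Section IdealPowers.
Variable R : comNzRingType.
Implicit Types (J c : submodClosed R^o) (V : lmodType R).

Lemma ideal_mulr J (a b : R) : b \in J -> a * b \in J.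
Proof. exact: (@rpredZ R R^o J a b). Qed.

Lemma ideal_mull J (a b : R) : a \in J -> a * b \in J.
Proof. by rewrite mulrC; apply: ideal_mulr. Qed.

Lemma mem_exp0 J (a : R) : a \in ideal_exp J 0.
Proof. exact: (proj2 (mem_mk_submod (conj I (fun _ _ _ _ _ => I) :
  is_submod (fun _ : R^o => True)) (a : R^o)) I). Qed.

Lemma mem_expS J n (a b : R) : a \in J -> b \in ideal_exp J n -> a * b \in ideal_exp J n.+1.
Proof. by move=> aJ bJ; apply: mem_span; exists a, b. Qed.

Lemma mem_expX J n (a : R) : a \in J -> a ^+ n \in ideal_exp J n.
Proof.
move=> aJ; elim: n => [|n IH]; first exact: mem_exp0.
by rewrite exprS mem_expS.
Qed.

Lemma exp_sub1 J : {subset ideal_exp J 1 <= J}.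
Proof. by apply: span_sub => _ [a [b [aJ _ ->]]]; apply: (ideal_mull (J := J)). Qed.

Lemma exp_le J n k : (n <= k)%N -> {subset ideal_exp J k <= ideal_exp J n}.
Proof.
move=> /subnK <-; elim: (k - n)%N => // d IH a.
by rewrite addSn => /ideal_exp_decr /IH.
Qed.

Lemma is_submod_colon V (T : submodClosed V) (P : V -> Prop) :
  is_submod (fun a : R^o => forall v, P v -> (a : R) *: v \in T).
Proof.
split=> [v _|a u v hu hv w Pw]; first by rewrite scale0r rpred0.
rewrite scalerDl -[(a *: u : R) *: w]/((a * (u : R)) *: w) -scalerA.
by apply: rpredD; [apply/rpredZ/hu | apply: hv].
Qed.
(** The conductor ideal (T : P). Taking P to be any set of vectors covers annihilators of single
    elements and of submodules alike. *)
Definition colon V (T : submodClosed V) P := mk_submod (is_submod_colon T P).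

Lemma mem_colon V (T : submodClosed V) P (a : R) :
  a \in colon T P <-> forall v, P v -> a *: v \in T.
Proof. exact: (mem_mk_submod (is_submod_colon T P)). Qed.

(** Stands in for J^(k+l) = J^k J^l. The target c is kept general because the inductive step
    replaces it by its conductor (c : a), a being the factor split off. *)
Lemma exp_add_sub J k l c :
  (forall b d : R, b \in ideal_exp J k -> d \in ideal_exp J l -> b * d \in c) ->
  {subset ideal_exp J (k + l) <= c}.
Proof.
elim: k c => [|k IH] c h.
  by move=> d dJ; rewrite -[d]mul1r; apply: h => //; apply: mem_exp0.
rewrite addSn; apply: span_sub => _ [a [d [aJ dJ ->]]].
have : d \in colon c (fun v => v = a).
  apply: (IH (colon c (fun v => v = a))) dJ => b e bJ eJ.
  apply/mem_colon => _ ->; rewrite [_ *: _]mulrC mulrA.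
  by apply: h => //; apply: mem_expS.
by move=> /mem_colon /(_ a erefl); rewrite [_ *: _]mulrC.
Qed.

(** Noetherian induction on c. In a maximal counterexample pick x in J outside c, and n with x^n
    outside c but x^(n+1) inside. Both c + (x^n) and (c : x^n) are strictly larger, so each contains
    a power of J, and the product of these two powers lies in c. *)
Lemma exp_sub_of_nil J c : noetherian R^o ->
  (forall x : R, x \in J -> exists n, x ^+ n \in c) ->
  exists k, {subset ideal_exp J k <= c}.
Proof.
move=> nR nilc; apply: contrapT => noc.
pose P c := (forall x : R, x \in J -> exists n, x ^+ n \in c) /\
  ~ exists k, {subset ideal_exp J k <= c}.
have [//|{nilc noc} {}c [[nilc noc] cmax]] := noetherian_max (P := P) nR (S0 := c).
have larger (d : submodClosed R^o) (y : R) : {subset c <= d} -> y \in d -> y \notin c ->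
    exists k, {subset ideal_exp J k <= d}.
  move=> cd yd /negP yc; apply: contrapT => nod; apply/yc/(cmax d) => //; split=> // x xJ.
  by have [n /cd] := nilc x xJ; exists n.
have [x [xJ xc]] : exists x : R, x \in J /\ x \notin c.
  apply: contrapT => h; apply: noc; exists 1%N => x /exp_sub1 xJ.
  by apply: contrapT => /negP xc; apply: h; exists x.
have exn : exists n, x ^+ n \in c by have [n] := nilc x xJ; exists n.
case: (ex_minnP exn) => -[|n] xnc nmin.
  by apply: noc; exists 0%N => a _; rewrite -[a]mulr1; apply: ideal_mulr.
have yc : x ^+ n \notin c by apply/negP => /nmin; rewrite ltnn.
have [||k1 hk1] := larger (add_submod c (cyclic_submod (x ^+ n : R^o))) (x ^+ n) _ _ yc.
- exact: sub_addl.
- exact/sub_addr/cyclic_id.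
have [||k2 hk2] := larger (colon c (fun v => v = x ^+ n)) x _ _ xc.
- by move=> a ac; apply/mem_colon => _ ->; apply: ideal_mull.
- by apply/mem_colon => _ ->; rewrite [_ *: _]mulrC -exprSr.
apply: noc; exists (k2 + k1)%N; apply: exp_add_sub => b d /hk2 /mem_colon /(_ _ erefl) by_.
move=> /hk1 /mem_add [u [v [uc /mem_cyclic [r ->] ->]]].
suff : (b * u : R^o) + (r * (b * x ^+ n) : R^o) \in c.
  by rewrite mulrCA -mulrDr.
by apply: rpredD; apply: ideal_mulr.
Qed.

Lemma sub_colon_of_nil V (J : submodClosed R^o) (T : submodClosed V) (P : V -> Prop) :
  noetherian R^o ->
  (forall x : R, x \in J -> exists n, forall v, P v -> x ^+ n *: v \in T) ->
  exists k, forall (a : R) v, a \in ideal_exp J k -> P v -> a *: v \in T.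
Proof.
move=> nR h; have [|k hk] := @exp_sub_of_nil J (colon T P) nR.
  by move=> x /h [n hn]; exists n; apply/mem_colon.
by exists k => a v /hk /mem_colon; apply.
Qed.

(** Let T be maximal among the submodules of W that meet V exactly in J^t V. Every x in J is
    nilpotent on W/T, since otherwise T + x^n W would be a larger candidate; hence some power of J
    maps W into T, and its trace on V lies in J^t V. *)
Lemma artin_rees V (W : lmodType R) (f : {linear V -> W}) J t : noetherian R^o -> noetherian W ->
  injective f ->
  exists t', forall y, f y \in smul (ideal_exp J t') W -> y \in smul (ideal_exp J t) V.
Proof.
move=> nR nW f_inj.
pose P (T : submodClosed W) := {subset im_submod f (smul (ideal_exp J t) V) <= T} /\
  forall y, f y \in T -> y \in smul (ideal_exp J t) V.
have [|T [[fT Tf] Tmax]] :=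
    noetherian_max (P := P) nW (S0 := im_submod f (smul (ideal_exp J t) V)).
  by split=> // y /mem_im [z zV /f_inj <-].
have [|t' ht'] := @sub_colon_of_nil W J T (fun _ => True) nR.
  move=> x xJ; have [n w|k hk] := nW (fun n => preim_submod (scalemap W (x ^+ n)) T).
    by rewrite !mem_preim !scalemapE exprS -scalerA; apply: rpredZ.
  (* From n >= t, x^n y lies in J^t V and hence in T; from n >= k, x^(2n) w in T forces x^n w in
     T. *)
  pose n := maxn k t; exists n => v _.
  pose T' := add_submod T (range (scalemap W (x ^+ n))).
  apply: (Tmax T'); last 2 first.
  - exact: sub_addl.
  - by apply/sub_addr/mem_range; exists v.
  split=> [w /fT wT|y /mem_add [u [_ [uT /mem_range [w <-] fy]]]]; first exact: sub_addl.
  have fxy : x ^+ n *: f y \in T.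
    rewrite -linearZ; apply/fT/mem_im; exists (x ^+ n *: y) => //.
    by apply: mem_smul; apply: (exp_le (leq_maxr k t)); apply: mem_expX.
  apply: Tf; rewrite fy rpredD // -[_ \in T]/(scalemap W (x ^+ n) w \in T) -mem_preim.
  rewrite hk ?leq_maxl // -(hk (n + n)%N); last by rewrite (leq_trans (leq_maxl k t)) ?leq_addr.
  rewrite mem_preim scalemapE exprD -scalerA.
  by move: fxy; rewrite fy scalerDr => /submodB /(_ (rpredZ (x ^+ n) uT)); rewrite addrC addKr.
by exists t' => y yJ; apply: Tf; move: yJ; apply: smul_sub => a v aJ; apply: ht'.
Qed.

(** The mirror image of [artin_rees]: K is minimal with x K = 0 :_V J^t. For a in J the images a^n K
    stabilise, so K and its part killed by a^n have the same image under x; minimality makes a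
    nilpotent on K, and a power of J kills K. *)
Lemma artin_rees_dual V J (x : R) t : noetherian R^o -> artinian V ->
  (forall y : V, exists z, x *: z = y) ->
  exists t', forall y, y \in ann_sub V (ideal_exp J t) ->
    exists2 z, z \in ann_sub V (ideal_exp J t') & x *: z = y.
Proof.
move=> nR aV x_surj; pose A := ann_sub V (ideal_exp J t).
pose P (K : submodClosed V) := (forall z, z \in K -> x *: z \in A) /\
  forall y, y \in A -> exists2 z, z \in K & x *: z = y.
have [|K [[KA AK] Kmin]] := artinian_min (P := P) aV (S0 := preim_submod (scalemap V x) A).
  split=> [z|y yA]; first by rewrite mem_preim.
  by have [z xz] := x_surj y; exists z => //; rewrite mem_preim scalemapE xz.
have [|t' ht'] := @sub_colon_of_nil V J (zero_submod V) (fun v => v \in K) nR.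
  move=> a aJ; have [n w|k hk] := aV (fun n => im_submod (scalemap V (a ^+ n)) K).
    move=> /mem_im [z zK <-]; apply/mem_im; exists (a *: z); first exact: rpredZ.
    by rewrite !scalemapE exprSr scalerA.
  pose n := maxn k t; exists n => v vK.
  pose K' := cap_submod K (preim_submod (scalemap V (a ^+ n)) (zero_submod V)).
  suff /(Kmin K') /(_ _ v vK) : P K'.
    by case/(_ _)/mem_cap => [z /mem_cap[]//|_]; rewrite mem_preim.
  split=> [z /mem_cap [/KA]//|y yA]; have [z zK xz] := AK y yA.
  have : scalemap V (a ^+ n) z \in im_submod (scalemap V (a ^+ n)) K.
    by apply/mem_im; exists z.
  rewrite hk ?leq_maxl // -(hk (n + n)%N); last by rewrite (leq_trans (leq_maxl k t)) ?leq_addr.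
  move=> /mem_im [z' z'K]; rewrite !scalemapE => az'.
  (* The correction makes z vanish under a^n without changing x z: x z' lies in A, which is killed
     by a^n because n >= t. *)
  exists (z - a ^+ n *: z').
    apply/mem_cap; split; first by rewrite submodB ?rpredZ.
    by rewrite mem_preim; apply/mem_zero; rewrite scalemapE scalerBr scalerA -exprD az' subrr.
  rewrite scalerBr xz scalerA mulrC -scalerA.
  have /mem_mk_submod -> := KA z' z'K; first by rewrite subr0.
  by apply: (exp_le (leq_maxr k t)); apply: mem_expX.
exists t' => y /AK [z zK xz]; exists z => //.
by apply/mem_mk_submod => a aJ; apply/mem_zero/ht'.
Qed.

End IdealPowers.

(** * Noetherian modules killed by a power of the maximal ideal *)

Section LocalRing.
Variables (R : comNzRingType) (m : submodClosed R^o).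
Hypotheses (nR : noetherian R^o) (m_max : maximal_ideal m).
Implicit Types V : lmodType R.

Lemma maximal_inv (x : R) : x \notin m -> exists b : R, 1 - b * x \in m.
Proof.
move=> xm; have [_ mm] := m_max; apply: contrapT => h.
pose J := add_submod m (cyclic_submod (x : R^o)).
suff /mm : 1 \notin J.
  move=> /(_ (@sub_addl _ _ _ _)) Jm; case/negP: xm.
  apply: etrans (esym (Jm x)) _; exact/sub_addr/cyclic_id.
apply/negP => /mem_add [u [v [um /mem_cyclic [b ->] e]]]; apply: h; exists b.
by rewrite e addrK.
Qed.

Lemma artinian_simple V (y : V) : (forall v, exists a : R, v = a *: y) ->
  (forall a : R, a \in m -> a *: y = 0) -> artinian V.
Proof.
move=> geny my N decN.
have decN' k n : (k <= n)%N -> {subset N n <= N k}.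
  by move=> /subnK <-; elim: (n - k)%N => // d IH v; rewrite addSn => /decN /IH.
have [[k yk]|h] := EM (exists k, y \notin N k); last first.
  exists 0%N => n _ v; have [a ->] := geny v.
  by rewrite !rpredZ //; apply: contrapT => /negP yN; apply: h; eexists; exact: yN.
have N0 n v : (k <= n)%N -> v \in N n -> v = 0.
  move=> kn; have [a -> aN] := geny v; have [/my//|am] := boolP (a \in m).
  have [b bm] := maximal_inv am; case/negP: yk; apply: (decN' k n kn).
  by rewrite -[y]scale1r -(subrK (b * a) 1) scalerDl my // add0r -scalerA rpredZ.
by exists k => n kn v; apply/idP/idP => /N0 ->; rewrite ?rpred0.
Qed.

(** A maximal artinian submodule S is everything: otherwise V/S, being killed by m^s, has a nonzero
    element y killed by m, and S + R y is an extension of S by a simple module. *)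
Lemma artinian_of_killed V s : noetherian V ->
  (forall (a : R) (v : V), a \in ideal_exp m s -> a *: v = 0) -> artinian V.
Proof.
move=> nV kV; pose P (S : submodClosed V) := artinian (submod S).
have [|S [aS Smax]] := noetherian_max (P := P) nV (S0 := zero_submod V).
  exact/artinian_trivial/zero_submodP.
suff Sfull v : v \in S.
  by apply: (@artinian_surj _ _ _ (@submod_val R V S)) aS => y; exists (Submod (Sfull y)).
apply: contrapT => /negP vS.
have [y yS my] : exists2 y, y \notin S & forall a : R, a \in m -> a *: y \in S.
  have : forall a : R, a \in ideal_exp m s -> a *: v \in S.
    by move=> a /kV ->; apply: rpred0.
  elim: s v vS {kV} => [|s IH] v vS hv.
    by case/negP: vS; rewrite -[v]scale1r hv ?mem_exp0.
  have [[a [am avS]]|] := EM (exists a : R, a \in m /\ a *: v \notin S).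
    apply: (IH _ avS) => b bm.
    by rewrite scalerA mulrC; apply/hv/mem_expS.
  move=> h; exists v => // a am; apply: contrapT => /negP aS'.
  by apply: h; exists a.
pose T := add_submod S (cyclic_submod y).
have yT : y \in T by apply/sub_addr/cyclic_id.
case/negP: yS; apply: (Smax T) => //; last exact: sub_addl.
pose S' := preim_submod (@submod_val R V T) S.
have [|x|f fE] := @linear_factor R (submod S) (submod T) V (@submod_val R V S) (@submod_val R V T).
- exact: submod_val_inj.
- by exists (Submod (sub_addl _ (submodP x))).
apply: (@artinian_exact _ _ _ _ f (qproj S')) => // [z /qproj_eq0|].
  rewrite mem_preim => zS; exists (Submod zS); apply: val_inj; exact: fE.
apply: (@artinian_simple _ (qproj S' (Submod yT))) => [v'|a am]; last first.
  by rewrite -linearZ; apply/qproj_eq0; rewrite mem_preim; apply: my.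
have [z <-] := qproj_surj v'; have /mem_add [u [_ [uS /mem_cyclic [a ->] e]]] := submodP z.
exists a; rewrite -linearZ; apply/qproj_eq; rewrite mem_preim linearB /=.
by rewrite e addrK.
Qed.

End LocalRing.

(** * Prime avoidance and associated primes *)

Section PrimeAvoidance.
Variables (R : comNzRingType) (m : submodClosed R^o).

(** Prime ideals as bare predicates, allowed to be empty or all of R. The instance of interest is
    the set of x with x S <> S, which is empty when S = 0. *)
Record primelike (P : R -> Prop) : Prop := Primelike {
  primelike_add : forall x y, P x -> P y -> P (x + y);
  primelike_mull : forall x y, P x -> P (x * y);
  primelike_mul : forall x y, P (x * y) -> P x \/ P y
}.

(** By induction, for each j some x_j in m avoids every predicate other than P j. If none of these
    elements avoids P j as well, the sum of the last x_j and the product of the others avoids them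
    all. *)
Lemma prime_avoidance n (P : nat -> R -> Prop) :
  (forall i, (i < n)%N -> primelike (P i)) ->
  (forall i, (i < n)%N -> exists2 x : R, x \in m & ~ P i x) ->
  exists2 x : R, x \in m & forall i, (i < n)%N -> ~ P i x.
Proof.
elim: n P => [|n IH] P prP avP; first by exists 0 => //; exact: (rpred0 m).
have bump_lt j i : (i < n)%N -> (bump j i < n.+1)%N.
  by move=> i_n; rewrite /bump; case: (j <= i)%N; rewrite ?add1n // add0n leqW.
have skip j : (j < n.+1)%N ->
    exists2 x : R, x \in m & forall i, (i < n.+1)%N -> i <> j -> ~ P i x.
  move=> jn; have [i||x xm hx] := IH (fun i => P (bump j i)).
  - move=> i_n; apply: prP; exact: bump_lt.
  - move=> i i_n; apply: avP; exact: bump_lt.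
  exists x => // i i_n ij; have := hx (unbump j i); rewrite unbumpKcond.
  rewrite (introF eqP ij) /=; apply.
  rewrite /unbump; case: (ltnP j i) => [ji|ij'] /=.
    by rewrite subn1; case: i i_n ji {ij} => // i.
  by rewrite subn0 (leq_trans _ (_ : j <= n)%N) // ltn_neqAle ij' andbT; apply/eqP.
have [[j [jn [x xm hx]]]|bad] := EM (exists j, (j < n.+1)%N /\
    exists2 x : R, x \in m & forall i, (i < n.+1)%N -> ~ P i x).
  by exists x.
have {}bad j (jn : (j < n.+1)%N) : exists2 x : R, x \in m &
    P j x /\ forall i, (i < n.+1)%N -> i <> j -> ~ P i x.
  have [x xm hx] := skip j jn; exists x => //; split=> //.
  apply: contrapT => Px; apply: bad; exists j; split=> //; exists x => // i i_n.
  by have [->|/eqP/(hx i i_n)] := eqVneq i j.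
clear IH skip bump_lt; case: n => [|n] in P prP avP bad *.
  by have [x xm hx] := avP 0%N isT; exists x => // -[].
have /choice [x xP] : forall j, exists x : R, (j < n.+2)%N ->
    [/\ x \in m, P j x & forall i, (i < n.+2)%N -> i <> j -> ~ P i x].
  move=> j; have [/bad [x xm [h1 h2]]|_] := ltnP j n.+2; first by exists x.
  by exists 0.
pose y := \prod_(j < n.+1) x j.
have ym : y \in m.
  rewrite /y big_ord_recl; apply: (ideal_mull (J := m)).
  by have [] := xP 0%N isT.
have Py i : (i < n.+1)%N -> P i y.
  move=> i_n; rewrite /y (bigD1 (Ordinal i_n)) //=; apply: primelike_mull.
    exact/prP/ltnW.
  by have [] := xP i (ltnW i_n).
have nPy : ~ P n.+1 y.
  have prn := prP n.+1 (ltnSn _); have [z _ zP] := avP n.+1 (ltnSn _).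
  rewrite /y; apply: (big_ind (fun y => ~ P n.+1 y)).
  - by move=> /(primelike_mull prn z); rewrite mul1r.
  - by move=> a b Pa Pb /(primelike_mul prn) [].
  - move=> j _; have jn : (j < n.+2)%N by apply: leqW.
    have [_ _] := xP j jn; apply=> //.
    by move=> e; have := ltn_ord j; rewrite -e ltnn.
have sub i a b : (i < n.+2)%N -> P i (a + b) -> P i a -> P i b.
  move=> /prP pri Pab Pa; rewrite -(addKr a b).
  by rewrite -mulN1r [-1 * a]mulrC; apply: primelike_add => //; apply: primelike_mull.
exists (x n.+1 + y).
  by apply: (@rpredD _ m) => //; have [] := xP n.+1 (ltnSn _).
move=> i; rewrite ltnS leq_eqVlt => /orP[/eqP ->|i_n] Pxy.
  by apply/nPy/(sub _ _ _ _ Pxy) => //; have [] := xP n.+1 (ltnSn _).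
have [_ _ /(_ i (ltnW i_n))] := xP n.+1 (ltnSn _); apply.
  by move=> e; rewrite e ltnn in i_n.
by rewrite addrC in Pxy; apply: sub Pxy (Py i i_n); apply: ltnW.
Qed.

End PrimeAvoidance.

Section AnnihilatorPrimes.
Variables (R : comNzRingType) (m : submodClosed R^o).

(** If no power of a kills z, choose an annihilator maximal among those of elements not killed by
    any power of a. It is prime, hence an associated prime, hence m; but then a kills the
    element. *)
Lemma torsion_of_ass (N : lmodType R) : noetherian R^o ->
  (forall p, ass N p -> p =i m) ->
  forall (a : R) (z : N), a \in m -> exists n, a ^+ n *: z = 0.
Proof.
move=> nR assN a z am; apply: contrapT => noz.
pose ann y := colon (zero_submod N) (fun v => v = y).
have annP y (b : R) : b \in ann y <-> b *: y = 0.
  split=> [/mem_colon /(_ y erefl)/mem_zero //|by0].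
  by apply/mem_colon => _ ->; apply/mem_zero.
pose P S := exists y, (forall n, a ^+ n *: y <> 0) /\ S = ann y.
have [|S [[y [ay ->]] Smax]] := noetherian_max (P := P) nR (S0 := ann z).
  by exists z; split=> // n an; apply: noz; exists n.
have annM (b c : R) : b * c \in ann y -> b \notin ann y -> c \in ann y.
  move=> bc; apply: contraNT => cy.
  have grow w : P (ann w) -> (forall d : R, d *: y = 0 -> d *: w = 0) ->
      forall d : R, d *: w = 0 -> d *: y = 0.
    move=> Pw yw d dw; apply/annP; apply: (Smax _ Pw); last exact/annP.
    by move=> e /annP /yw /annP.
  have [[n anby]|aby] := EM (exists n, a ^+ n *: (b *: y) = 0).
    apply/annP; apply: (grow (a ^+ n *: y)).
    - exists (a ^+ n *: y); split=> // k.
      by rewrite scalerA -exprD; apply: ay.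
    - by move=> d dy; rewrite scalerA mulrC -scalerA dy scaler0.
    - by rewrite scalerA mulrC -scalerA.
  case/negP: cy; apply/annP; apply: (grow (b *: y)).
  - by exists (b *: y); split=> // n e; apply: aby; exists n.
  - by move=> d dy; rewrite scalerA mulrC -scalerA dy scaler0.
  - by rewrite scalerA mulrC; apply/annP.
have annE : ass N (ann y).
  split; last by exists y => b; apply: annP.
  split.
    apply/negP => /annP; rewrite scale1r => y0.
    by apply: (ay 0%N); rewrite y0 scaler0.
  move=> b c bc; have [//|/= bn] := boolP (b \in ann y).
  exact: annM bc bn.
apply: (ay 1%N); rewrite expr1; apply/annP.
by rewrite (assN _ annE).
Qed.

(** R/p embeds in N as R x, and an artinian domain is a field: the chain R a^n x stops, so a^k (1 -
    b a) lies in p for some b. *)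
Lemma ass_of_artinian (N : lmodType R) p : local_ring m -> artinian N -> ass N p -> p =i m.
Proof.
move=> [_ m_uniq] aN [[p1 pprime] [x px]]; apply: m_uniq; split=> // J J1 pJ a.
apply/idP/idP; last exact: pJ.
move=> aJ; apply: contrapT => /negP ap.
have [n v|k hk] := aN (fun n => cyclic_submod (a ^+ n *: x)).
  move=> /mem_cyclic [b ->]; apply/mem_cyclic; exists (b * a).
  by rewrite exprS !scalerA mulrA.
have : a ^+ k *: x \in cyclic_submod (a ^+ k.+1 *: x) by rewrite hk // cyclic_id.
move=> /mem_cyclic [b e].
have : a ^+ k * (1 - b * a) \in p.
  apply/px; rewrite mulrBr mulr1 scalerBl {1}e scalerA exprS.
  by rewrite [in X in _ - X]mulrA [a ^+ k * b]mulrC -mulrA [a ^+ k * a]mulrC subrr.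
move=> /pprime /orP[].
  elim: k {hk e} => [|k IH]; first by rewrite (negbTE p1).
  by rewrite exprS => /pprime /orP[|/IH]; first by rewrite (negbTE ap).
move=> /pJ h; case/negP: J1.
rewrite -(subrK (b * a) 1); apply: (@rpredD _ J) => //; exact: ideal_mulr.
Qed.

End AnnihilatorPrimes.

(** * Structure of artinian modules *)

Section ArtinianStructure.
Variables (R : comNzRingType) (m : submodClosed R^o).
Hypotheses (nR : noetherian R^o) (m_max : maximal_ideal m).

(** Submodules of submodules of M are different types, and Q is not assumed invariant under
    isomorphism; a minimal counterexample is therefore sought among the images in M of injections
    from modules violating Q. *)
Lemma artinian_ind (Q : lmodType R -> Prop) :
  (forall M, artinian M ->
     (forall T : submodClosed M, (exists x, x \notin T) -> Q (submod T)) -> Q M) ->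
  forall M, artinian M -> Q M.
Proof.
move=> hQ M aM; apply: contrapT => nQ.
pose P (S : submodClosed M) := exists (L : lmodType R) (f : {linear L -> M}),
  [/\ injective f, ~ Q L & S =i range f].
have [|S [[L [f [f_inj nQL Sf]]] Smin]] :=
  artinian_min (P := P) aM (S0 := range (idfun : {linear M -> M})).
  by exists M, idfun; split.
apply: nQL; apply: hQ (artinian_inj f_inj aM) _ => T [x xT]; apply: contrapT => nQT.
pose g : {linear submod T -> M} := f \o @submod_val R L T.
have : P (range g).
  by exists (submod T), g; split=> // y z /f_inj /val_inj.
move=> /Smin Sg; have /mem_range [z /f_inj e] : f x \in range g.
  apply: Sg => [y /mem_range [z <-]|]; rewrite Sf; apply/mem_range; last by exists x.
  by exists (submod_val z).
by case/negP: xT; rewrite -e submodP.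
Qed.

(** Sum-irreducible (hollow) submodules, zero included: the dual of the meet-irreducible submodules
    of primary decomposition. *)
Definition irreducible_submod (V : lmodType R) (S : submodClosed V) :=
  forall A B : submodClosed V, {subset S <= add_submod A B} ->
    {subset A <= S} -> {subset B <= S} -> {subset S <= A} \/ {subset S <= B}.

Definition stable_by (V : lmodType R) (x : R) (S : submodClosed V) :=
  forall v, v \in S -> exists2 z, z \in S & x *: z = v.

Section Irreducible.
Variables (V : lmodType R) (S : submodClosed V).
Hypothesis S_irr : irreducible_submod S.

Let im_sub (x : R) : {subset im_submod (scalemap V x) S <= S}.
Proof. by move=> _ /mem_im [z zS <-]; apply: rpredZ. Qed.

Lemma irreducible_primelike : primelike (fun x : R => ~ stable_by x S).
Proof.
split=> [x y nx ny hxy|x y nx hxy|x y nxy].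
- have [|||h|h] := S_irr (A := im_submod (scalemap V x) S) (B := im_submod (scalemap V y) S).
  + move=> v /hxy [z zS <-]; rewrite scalerDl; apply: rpredD.
      by apply/sub_addl/mem_im; exists z.
    by apply/sub_addr/mem_im; exists z.
  + exact: im_sub.
  + exact: im_sub.
  + by apply: nx => v /h /mem_im.
  + by apply: ny => v /h /mem_im.
- apply: nx => v /hxy [z zS <-]; exists (y *: z); first exact: rpredZ.
  by rewrite scalerA.
- apply: contrapT => /not_orP [/contrapT hx /contrapT hy]; apply: nxy => v /hx [z /hy [w wS <-] <-].
  by exists w => //; rewrite scalerA.
Qed.

(** A Fitting argument: once the images x^n S are stable, S is the sum of x^(k+1) S and the kernel
    of x^(k+1) on S. Irreducibility leaves one of them, and x S <> S rules out the first. *)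
Lemma irreducible_nil x : artinian V -> ~ stable_by x S ->
  exists n, forall v, v \in S -> x ^+ n *: v = 0.
Proof.
move=> aV nx.
have [n v|k hk] := aV (fun n => im_submod (scalemap V (x ^+ n)) S).
  move=> /mem_im [z zS <-]; apply/mem_im; exists (x *: z); first exact: rpredZ.
  by rewrite !scalemapE scalerA -exprSr.
pose K := cap_submod S (preim_submod (scalemap V (x ^+ k.+1)) (zero_submod V)).
have [|||h|h] := S_irr (A := im_submod (scalemap V (x ^+ k.+1)) S) (B := K).
- move=> v vS.
  have : x ^+ k.+1 *: v \in im_submod (scalemap V (x ^+ k.+1)) S by apply/mem_im; exists v.
  rewrite hk // -(hk (k.+1 + k.+1)%N); last by rewrite (leq_trans (leqnSn k)) ?leq_addr.
  move=> /mem_im [w wS]; rewrite scalemapE exprD -scalerA => e.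
  apply/mem_add; exists (x ^+ k.+1 *: w), (v - x ^+ k.+1 *: w); split.
  + by apply/mem_im; exists w.
  + apply/mem_cap; split; first by rewrite submodB ?rpredZ.
    by rewrite mem_preim; apply/mem_zero; rewrite scalemapE scalerBr e subrr.
  + by rewrite addrCA subrr addr0.
- exact: im_sub.
- by move=> v /mem_cap [].
- case: nx => v /h /mem_im [z zS <-]; exists (x ^+ k *: z); first exact: rpredZ.
  by rewrite scalerA -exprS.
- exists k.+1 => v /h /mem_cap [_]; rewrite mem_preim => /mem_zero.
  by rewrite scalemapE.
Qed.

(* A submodule maximal among those containing m S and missing x <> 0 mod m S  *)
(* is a complement of R x, so by irreducibility S = R x.                      *)
Lemma irreducible_cyclic k : (forall (a : R) v, a \in ideal_exp m k -> v \in S -> a *: v = 0) ->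
  exists y, {subset S <= cyclic_submod y} /\ y \in S.
Proof.
move=> kS.
pose mS := im_submod (@submod_val R V S) (smul m (submod S)).
have mSS : {subset mS <= S} by move=> _ /mem_im [z _ <-]; apply: submodP.
have mem_mS (a : R) v : a \in m -> v \in S -> a *: v \in mS.
  move=> am vS; apply/mem_im; exists (a *: Submod vS) => //; exact: mem_smul.
(* If S = mS then S = m^k S = 0; the induction lowers k one unit at a time, down to m^0 = R. *)
have [SmS|] := EM {subset S <= mS}.
  have S0 v : v \in S -> v = 0.
    elim: k kS v => [|k IH] kS v; last first.
      move=> vS; apply: IH vS => a {}v am /SmS /mem_im [w wm <-].
      have : w \in preim_submod (scalemap V a \o @submod_val R V S) (zero_submod V).
        move: wm; apply: smul_sub => b u bm; rewrite mem_preim; apply/mem_zero.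
        rewrite /= scalemapE linearZ /= scalerA kS ?submodP //.
        exact: mem_expS.
      by rewrite mem_preim => /mem_zero.
    by move=> vS; rewrite -[v]scale1r kS // mem_exp0.
  by exists 0; split=> [v /S0 ->|]; rewrite ?rpred0.
move=> /existsNP [x /not_implyP [xS /negP xmS]].
(* Zorn's lemma is applied to sets under unions of chains, and the empty chain has empty union.
   Adjoining mS through [sat] turns even the empty set into an admissible submodule. *)
pose sat (A : classical_sets.set V) v := v \in mS \/ A v.
pose P A := [/\ is_submod (sat A), (forall v, A v -> v \in S) & ~ sat A x].
have [F FP Ftot|A [[subA AS xA] Amax]] := @classical_sets.Zorn_bigcup V P.
  split=> [|v [A FA] Av|].
  - split=> [|a u v]; first by left; rewrite rpred0.
    have inF A w : F A -> sat A w -> sat (classical_sets.bigcup F id) w.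
      by move=> FA [|Aw]; [left | right; exists A].
    have lin A : F A -> sat A u -> sat A v ->
        sat (classical_sets.bigcup F id) (a *: u + v).
      by move=> FA Au Av; apply: (inF A) => //; have [[_ h] _ _] := FP A FA; apply: h.
    move=> [um|[A FA Au]] [vm|[B FB Bv]].
    + by left; rewrite rpredD ?rpredZ.
    + by apply: (lin B) => //; [left | right].
    + by apply: (lin A) => //; [right | left].
    + have [AB|BA] := Ftot A B FA FB.
        by apply: (lin B) => //; right => //; apply: AB.
      by apply: (lin A) => //; right => //; apply: BA.
  - by have [_ + _] := FP A FA; apply.
  - move=> [xm|[A FA Ax]]; first by rewrite xm in xmS.
    by have [_ _] := FP A FA; apply; right.
pose K := mk_submod subA.
have KP v : v \in K <-> sat A v by apply: (mem_mk_submod subA).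
have KS : {subset K <= S} by move=> v /KP [/mSS|/AS].
have xK : x \notin K by apply/negP => /KP.
exists x; split=> //.
have [|||h|//] := S_irr (A := K) (B := cyclic_submod x) => //; last 2 first.
- by move=> _ /mem_cyclic [a ->]; apply: rpredZ.
- by case/negP: xK; apply: h.
move=> v vS; have [/sub_addl //|vK] := boolP (v \in K).
pose B w := w \in add_submod K (cyclic_submod v).
have xB : x \in add_submod K (cyclic_submod v).
  apply: contrapT => xB; apply: (Amax B).
    split=> [w Aw|/(_ v) BA]; first by apply/sub_addl/KP; right.
    case/negP: vK; apply/KP; right; apply: BA; exact/sub_addr/cyclic_id.
  have satB w : sat B w <-> B w.
    by split=> [[wm|//]|]; [apply/sub_addl/KP; left | right].
  split.
  - split=> [|a u w /satB hu /satB hw]; apply/satB; first exact: (rpred0 (add_submod _ _)).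
    exact: (rpredD (rpredZ a hu) hw).
  - by move=> w /mem_add [u [_ [/KS uS /mem_cyclic [a ->] ->]]]; rewrite rpredD ?rpredZ.
  - by move=> /satB.
move: xB => /mem_add [u [_ [uK /mem_cyclic [r ->] xE]]].
(* If r is in m, then x = u + r v lies in K. Otherwise b r is 1 modulo m for some b, and v = (1 - b
   r) v - b u + b x with (1 - b r) v in mS. *)
have [rm|rm] := boolP (r \in m).
  case/negP: xK; rewrite xE rpredD //; apply/KP; left; exact: mem_mS.
have [b bm] := maximal_inv m_max rm.
apply/mem_add; exists ((1 - b * r) *: v - b *: u), (b *: x); split.
- by apply: submodB; [apply/KP; left; apply: mem_mS | apply: rpredZ].
- by apply/mem_cyclic; exists b.
- by rewrite xE scalerDr scalerBl scale1r scalerA addrA subrK subrK.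
Qed.

End Irreducible.

Definition sum_submod (V : lmodType R) (Ss : seq (submodClosed V)) : submodClosed V :=
  foldr (@add_submod R V) (zero_submod V) Ss.

Lemma sum_submod_cat (V : lmodType R) (Ss Ts : seq (submodClosed V)) :
  {subset add_submod (sum_submod Ss) (sum_submod Ts) <= sum_submod (Ss ++ Ts)}.
Proof.
move=> _ /mem_add [u [v [uS vT ->]]].
elim: Ss u uS => [|S Ss IH] u /=; first by move=> /mem_zero ->; rewrite add0r.
move=> /mem_add [s [w [sS /IH wS ->]]]; apply/mem_add; exists s, (w + v).
by rewrite addrA.
Qed.

Lemma stable_sum (V : lmodType R) (x : R) (Ss : seq (submodClosed V)) :
  (forall i, (i < size Ss)%N -> stable_by x (nth (zero_submod V) Ss i)) ->
  stable_by x (sum_submod Ss).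
Proof.
elim: Ss => [|S Ss IH] /= h.
  by move=> v /mem_zero ->; exists 0; rewrite ?rpred0 ?scaler0.
move=> _ /mem_add [u [v [/(h 0%N isT) [u' u'S <-] vS ->]]].
have [v' v'S <-] := IH (fun i => h i.+1) v vS.
exists (u' + v'); last by rewrite scalerDr.
by apply/mem_add; exists u', v'.
Qed.

(* An artinian module is a sum of irreducible submodules; each of these is    *)
(* either stable under some x in m, or cyclic and killed by a power of m.     *)
Lemma artinian_stable_part (V : lmodType R) : artinian V ->
  exists (T : submodClosed V) (k : nat) (x : R),
    [/\ noetherian (quotmod T),
        forall (a : R) (v : V), a \in ideal_exp m k -> a *: v \in T,
        x \in m & stable_by x T].
Proof.
move=> aV.
pose good (S : submodClosed V) := irreducible_submod S /\ exists2 x : R, x \in m & stable_by x S.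
pose D (S : submodClosed V) := exists (Ss : seq (submodClosed V)) (W : submodClosed V) (k : nat),
  [/\ forall i, (i < size Ss)%N -> good (nth (zero_submod V) Ss i),
      noetherian (submod W),
      forall (a : R) w, a \in ideal_exp m k -> w \in W -> a *: w = 0
    & {subset S <= add_submod (sum_submod Ss) W}].
have Dirr S : irreducible_submod S -> D S.
  move=> S_irr; have [[x [xm xS]]|nstab] := EM (exists x : R, x \in m /\ stable_by x S).
    exists [:: S], (zero_submod V), 0%N; split.
    - by case=> // _; split=> //; exists x.
    - exact/noetherian_trivial/zero_submodP.
    - by move=> a w _ /mem_zero ->; rewrite scaler0.
    - move=> v vS; apply: sub_addl; exact: sub_addl.
  have [|k hk] := @sub_colon_of_nil R V m (zero_submod V) (fun v => v \in S) nR.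
    move=> x xm; have [xS|n hn] := irreducible_nil S_irr aV (x := x).
      by apply: nstab; exists x.
    by exists n => v /hn ->; rewrite rpred0.
  have kS (a : R) v : a \in ideal_exp m k -> v \in S -> a *: v = 0.
    by move=> am vS; apply/mem_zero/hk.
  have [y [Sy yS]] := irreducible_cyclic S_irr kS.
  exists [::], S, k; split=> //; last by move=> v /sub_addr; apply.
  have [f fE] := cyclic_linear (Submod yS : submod S).
  apply: (@noetherian_surj _ _ _ f) nR => v; have /mem_cyclic [a e] := Sy _ (submodP v).
  by exists a; apply: val_inj; rewrite fE.
have Dsub (S T : submodClosed V) : {subset S <= T} -> D T -> D S.
  by move=> ST [Ss [W [k [h1 h2 h3 h4]]]]; exists Ss, W, k; split=> // v /ST /h4.
have Dadd A B : D A -> D B -> D (add_submod A B).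
  move=> [Ss [W [k [h1 h2 h3 h4]]]] [Ts [Z [l [g1 g2 g3 g4]]]].
  exists (Ss ++ Ts), (add_submod W Z), (maxn k l); split.
  - move=> i; rewrite size_cat nth_cat => iT.
    case: (ltnP i (size Ss)) => iS; first exact: h1.
    by apply: g1; rewrite ltn_subLR.
  - have [h hE] := pair_sum_linear (@submod_val R V W) (@submod_val R V Z).
    have [|p|j jE] := @linear_factor _ _ (submod (add_submod W Z)) _ h (@submod_val R V _).
    + exact: submod_val_inj.
    + have hp : h p \in add_submod W Z.
        case: p => w z; rewrite hE; apply/mem_add.
        by exists (submod_val w), (submod_val z); rewrite !submodP.
      by exists (Submod hp).
    apply: (@noetherian_surj _ _ _ j) (noetherian_prod h2 g2) => y.
    have /mem_add [w [z [wW zZ e]]] := submodP y.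
    by exists (Submod wW, Submod zZ); apply: val_inj; rewrite [LHS]jE hE; exact: esym e.
  - move=> a _ am /mem_add [w [z [wW zZ ->]]]; rewrite scalerDr (h3 a w) ?(g3 a z) ?addr0 //.
      exact: (exp_le (leq_maxr k l)).
    exact: (exp_le (leq_maxl k l)).
  - move=> _ /mem_add [_ [_ [/h4 /mem_add [s [w [sS wW ->]]] /g4 /mem_add [t [z [tT zZ ->]]] ->]]].
    rewrite addrACA rpredD //.
      by apply/sub_addl/sum_submod_cat/mem_add; exists s, t.
    by apply/sub_addr/mem_add; exists w, z.
have [Ss [W [k [goodS nW kW VS]]]] : D (full_submod V).
  apply: contrapT => nD.
  (* A minimal submodule without such a decomposition is irreducible: if it were the sum of two
     proper submodules, their decompositions would add up to one for it. *)
  have [//|S [nDS Smin]] := artinian_min (P := fun S => ~ D S) aV (S0 := full_submod V).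
  apply: (nDS); apply: Dirr => A B SAB AS BS; apply: contrapT => /not_orP [SA SB].
  apply: nDS; apply: Dsub SAB (Dadd _ _ _ _); apply: contrapT => nDA.
    by apply/SA/Smin.
  by apply/SB/Smin.
have [||x xm hx] := @prime_avoidance R m (size Ss)
    (fun i x => ~ stable_by x (nth (zero_submod V) Ss i)).
- by move=> i /goodS [/irreducible_primelike].
- by move=> i /goodS [_ [x xm xS]]; exists x.
exists (sum_submod Ss), k, x; split=> //.
- apply: (@noetherian_surj _ _ _ (qproj (sum_submod Ss) \o @submod_val R V W)) nW => y.
  have [v <-] := qproj_surj y; have /VS /mem_add [s [w [sS wW ->]]] := mem_full v.
  by exists (Submod wW); apply/qproj_eq; rewrite /= opprD addrCA subrr addr0 -scaleN1r rpredZ.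
- move=> a v am; have /VS /mem_add [s [w [sS wW ->]]] := mem_full v.
  by rewrite scalerDr (kW a w) // addr0 rpredZ.
- by apply: stable_sum => i /hx /contrapT.
Qed.

End ArtinianStructure.

(** * Long exact sequence in homology, tensor products *)

Section HomologyClasses.
Variables (R : comNzRingType).

(** Lets diagram chases run on chains: x is a cycle with class h, and the quotient of a submodule
    type stays out of sight. *)
Definition represents (C : complex R) n (h : homology C n) (x : C n) : Prop :=
  exists z : submod (cycles C n), submod_val z = x /\ qproj (boundaries C n) z = h.

Section Basic.
Variables (C : complex R) (n : nat).
Implicit Types (h : homology C n) (x : C n).

Lemma represents_ex h : exists x, represents h x.
Proof. by have [z zh] := qproj_surj h; exists (submod_val z), z. Qed.

Lemma represents_cycle h x : represents h x -> is_cycle x.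
Proof. by move=> [z [<- _]]; apply/(mem_mk_submod (@is_cycle_submod R C n))/submodP. Qed.

Lemma represents_of_cycle x : is_cycle x -> exists h, represents h x.
Proof.
move=> /(mem_mk_submod (@is_cycle_submod R C n)) xc.
by exists (qproj (boundaries C n) (Submod xc)), (Submod xc).
Qed.

Lemma represents_lin (a : R) h k x y : represents h x -> represents k y ->
  represents (a *: h + k) (a *: x + y).
Proof.
move=> [z [<- <-]] [w [<- <-]]; exists (a *: z + w); split=> //.
by rewrite linearP.
Qed.

Lemma represents_eq0 h x : represents h x -> h = 0 <-> exists y, x = bdry C n y.
Proof.
move=> [z [<- <-]]; rewrite qproj_eq0.
exact: (mem_mk_submod (@is_boundary_submod R C n)).
Qed.

Lemma representsZ (a : R) h x : represents h x -> represents (a *: h) (a *: x).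
Proof. by move=> [z [<- <-]]; exists (a *: z); split=> //; rewrite linearZ. Qed.

Lemma representsB h k x y : represents h x -> represents k y -> represents (h - k) (x - y).
Proof.
move=> hx ky; have := represents_lin (-1) ky hx.
by rewrite !scaleN1r ![- _ + _]addrC.
Qed.

Lemma represents_uniq h k x : represents h x -> represents k x -> h = k.
Proof.
move=> hx kx; apply/eqP; rewrite -subr_eq0; apply/eqP.
by apply/(represents_eq0 (representsB hx kx)); exists 0; rewrite linear0 subrr.
Qed.

End Basic.

Lemma represents0 (C : complex R) n : represents (0 : homology C n) 0.
Proof. by exists 0; split=> //; apply: linear0. Qed.

Lemma represents_map (C D : complex R) (f : chain_map C D) n h x :
  represents h x -> represents (homology_map f n h) (f n x).
Proof.
move=> [z [<- <-]]; exists (submap (@cycles_map _ _ _ f n) z); split=> //.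
by rewrite [RHS]quotmapE.
Qed.

Definition short_exact (A B C : lmodType R) (f : {linear A -> B}) (g : {linear B -> C}) :=
  [/\ injective f, forall c, exists b, g b = c & forall b, g b = 0 <-> exists a, f a = b].

(* The graph of the connecting homomorphism H_(i+1)(C) -> H_i(A) of the short *)
(* exact sequence of complexes given by f : A -> B and g : B -> C.            *)
Definition connecting (A B C : complex R) (f : chain_map A B) (g : chain_map B C) i
    (c : homology C i.+1) (a : homology A i) : Prop :=
  exists b x, [/\ f i x = bdry B i b, represents c (g i.+1 b) & represents a x].

Section LongExactSequence.
Variables (A B C : complex R) (f : chain_map A B) (g : chain_map B C).
Hypothesis fg : forall n, short_exact (f n) (g n).

Let f_inj n : injective (f n). Proof. by have [] := fg n. Qed.
Let g_surj n c : exists b, g n b = c. Proof. by have [_ + _] := fg n; apply. Qed.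
Let gf n b : g n b = 0 -> exists a, f n a = b. Proof. by have [_ _ h] := fg n; move/h. Qed.
Let gf0 n a : g n (f n a) = 0. Proof. by have [_ _ h] := fg n; apply/h; exists a. Qed.

Lemma homology_exact n (b : homology B n) : homology_map g n b = 0 ->
  exists a, homology_map f n a = b.
Proof.
have [y by_] := represents_ex b => /(represents_eq0 (represents_map g by_)) [c' gy].
have [b' b'c] := g_surj c'; subst c'.
have [|x fx] := @gf n (y - bdry B n b').
  by rewrite linearB gy cmap_bdry subrr.
have xc : is_cycle x.
  case: n b y by_ b' gy x fx => //= k b y by_ b' gy x fx; apply: f_inj.
  by rewrite cmap_bdry fx linearB bdryK (represents_cycle by_) subrr linear0.
have [a ax] := represents_of_cycle xc; exists a.
have := represents_map f ax; rewrite fx => fax.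
have [_ h] := represents_eq0 (representsB by_ fax).
apply/esym/eqP; rewrite -subr_eq0; apply/eqP/h; exists b'.
by rewrite opprB addrCA subrr addr0.
Qed.

Lemma connecting_exact_left i (a : homology A i) : homology_map f i a = 0 ->
  exists c, connecting f g c a.
Proof.
have [x ax] := represents_ex a => /(represents_eq0 (represents_map f ax)) [b fx].
have [|c cb] := @represents_of_cycle C i.+1 (g i.+1 b).
  by rewrite /= -cmap_bdry -fx gf0.
by exists c, b, x.
Qed.

Lemma connecting_total i (c : homology C i.+1) : exists a, connecting f g c a.
Proof.
have [z cz] := represents_ex c; have [b gb] := g_surj z; subst z.
have [|x fx] := @gf i (bdry B i b); first by rewrite cmap_bdry; apply: (represents_cycle cz).
have xc : is_cycle x.
  case: i c b cz x fx => //= k c b cz x fx; apply: f_inj.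
  by rewrite cmap_bdry fx bdryK linear0.
by have [a ax] := represents_of_cycle xc; exists a, b, x.
Qed.

(** The single-valuedness part; with [connecting_total] and [connecting_lin] it meets the hypotheses
    of [linear_of_relation]. *)
Lemma connecting0 i (a : homology A i) : connecting f g 0 a -> a = 0.
Proof.
move=> [b [x [fx gb ax]]]; apply/(represents_eq0 ax).
have [/(_ erefl) [c' gbE] _] := represents_eq0 gb.
have [b' b'c] := g_surj c'; subst c'.
have [|a' fa'] := @gf i.+1 (b - bdry B i.+1 b').
  by rewrite linearB gbE cmap_bdry subrr.
exists a'; apply: f_inj.
by rewrite fx cmap_bdry fa' linearB bdryK subr0.
Qed.

Lemma connecting_exact_right i (c : homology C i.+1) : connecting f g c 0 ->
  exists b, homology_map g i.+1 b = c.
Proof.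
move=> [b [x [fx gb x0]]]; have [/(_ erefl) [a' xE] _] := represents_eq0 x0.
have [|b' b'P] := @represents_of_cycle B i.+1 (b - f i.+1 a').
  by rewrite /= linearB -fx -cmap_bdry -xE subrr.
exists b'; have := represents_map g b'P.
by rewrite linearB gf0 subr0 => /represents_uniq; apply.
Qed.

Lemma connecting_lin i (u : R) (c c' : homology C i.+1) (a a' : homology A i) :
  connecting f g c a -> connecting f g c' a' -> connecting f g (u *: c + c') (u *: a + a').
Proof.
move=> [b [x [fx cb ax]]] [b' [x' [fx' cb' ax']]].
exists (u *: b + b'), (u *: x + x'); split; last exact: represents_lin.
- by rewrite !linearP fx fx'.
- by rewrite linearP; apply: represents_lin.
Qed.

End LongExactSequence.

Lemma connecting_map (A B C A' B' C' : complex R)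
    (f : chain_map A B) (g : chain_map B C) (f' : chain_map A' B') (g' : chain_map B' C')
    (p : chain_map A A') (q : chain_map B B') (r : chain_map C C') i c a :
  (forall n x, f' n (p n x) = q n (f n x)) -> (forall n x, g' n (q n x) = r n (g n x)) ->
  connecting f g c a -> connecting f' g' (homology_map r i.+1 c) (homology_map p i a).
Proof.
move=> fp gq [b [x [fx cb ax]]]; exists (q i.+1 b), (p i x); split.
- by rewrite fp fx cmap_bdry.
- by rewrite gq; apply: represents_map.
- exact: represents_map.
Qed.

End HomologyClasses.

Section TensorProducts.
Variable R : comNzRingType.

Lemma quot_lift (U V : lmodType R) (S : submodClosed U) (f : {linear U -> V}) :
  (forall x, x \in S -> f x = 0) ->
  exists g : {linear quotmod S -> V}, forall x, g (qproj S x) = f x.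
Proof.
move=> fS; have [|y|a x y u v|g gP] :=
    @linear_of_relation R (quotmod S) V (fun x y => exists z, qproj S z = x /\ f z = y).
- by move=> x; have [z zx] := qproj_surj x; exists (f z), z.
- by move=> [z [/qproj_eq0 /fS -> ->]].
- by move=> [z [<- <-]] [w [<- <-]]; exists (a *: z + w); rewrite !linearP.
exists g => x; have [z [/qproj_eq zx <-]] := gP (qproj S x).
by apply/eqP; rewrite -subr_eq0 -linearB fS.
Qed.

Section Bilinear.
Variables A B : lmodType R.

Lemma tens_linearl (a : R) (x x' : A) (y : B) :
  tens (a *: x + x') y = a *: tens x y + tens x' y.
Proof.
rewrite /tens -linearP; apply/qproj_eq; exact: mem_span (TensorL _ _ _ _).
Qed.

Lemma tens_linearr (a : R) (x : A) (y y' : B) :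
  tens x (a *: y + y') = a *: tens x y + tens x y'.
Proof.
rewrite /tens -linearP; apply/qproj_eq; exact: mem_span (TensorR _ _ _ _).
Qed.

Lemma tens0r (x : A) : tens x (0 : B) = 0.
Proof.
have := tens_linearr (-1) x 0 0.
by rewrite scaler0 addr0 scaleN1r addNr.
Qed.

Lemma tensZl (a : R) (x : A) (y : B) : tens (a *: x) y = a *: tens x y.
Proof. by have := tens_linearl a x 0 y; rewrite !addr0 tens0l addr0. Qed.

Lemma tensZr (a : R) (x : A) (y : B) : tens x (a *: y) = a *: tens x y.
Proof. by have := tens_linearr a x y 0; rewrite !addr0 tens0r addr0. Qed.

Lemma tensBl (x x' : A) (y : B) : tens (x - x') y = tens x y - tens x' y.
Proof.
by have := tens_linearl (-1) x' x y; rewrite !scaleN1r ![- _ + _]addrC.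
Qed.

Lemma tensor_gen (S : submodClosed (tensor A B)) :
  (forall x y, tens x y \in S) -> forall z, z \in S.
Proof.
move=> hS z; have [w <-] := qproj_surj z; rewrite -mem_preim.
by apply: freeg_gen => -[x y]; rewrite mem_preim; apply: hS.
Qed.

Lemma tens_lift (C : lmodType R) (h : A -> B -> C) :
  (forall a x x' y, h (a *: x + x') y = a *: h x y + h x' y) ->
  (forall a x y y', h x (a *: y + y') = a *: h x y + h x y') ->
  exists g : {linear tensor A B -> C}, forall x y, g (tens x y) = h x y.
Proof.
move=> hl hr; pose f : {linear {freeg (A * B)%type / R} -> C} := fglift (fun p => h p.1 p.2).
have fE p : f << p >> = h p.1 p.2 by apply: fglift1.
have [|g gP] := @quot_lift _ _ (Defs.span (@tensor_rel R A B)) f.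
  move=> x xS; have : x \in preim_submod f (zero_submod C).
    move: x xS; apply: span_sub => _ [a x x' y|a x y y']; rewrite mem_preim; apply/mem_zero;
    by rewrite linearB linearP !fE /= (hl, hr) subrr.
  by rewrite mem_preim => /mem_zero.
by exists g => x y; rewrite /tens gP fE.
Qed.

End Bilinear.
End TensorProducts.

(** * Tor *)

Section FreeTensor.
Variable R : comNzRingType.

Lemma tens_swap (A B : lmodType R) :
  exists w : {linear tensor A B -> tensor B A}, forall x y, w (tens x y) = tens y x.
Proof.
apply: (tens_lift (h := fun x y => tens y x)) => [a x x' y|a x y y'].
  exact: tens_linearr.
exact: tens_linearl.
Qed.

(** R^(K) tensor N is a direct sum of copies of N. Coordinate maps and a finite expansion suffice to
    test exactness coordinatewise. *)
Lemma free_coordl (K : choiceType) (N : lmodType R) :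
  exists c : K -> {linear tensor {freeg K / R} N -> N},
    (forall k p y, c k (tens p y) = coeff k p *: y) /\
    forall z, exists s : seq K, z = \sum_(k <- s) tens << k >> (c k z).
Proof.
have /choice [c cE] : forall k, exists c : {linear tensor {freeg K / R} N -> N},
    forall p y, c (tens p y) = coeff k p *: y.
  move=> k; apply: (tens_lift (h := fun (p : {freeg K / R}) y => coeff k p *: y)).
    by move=> a x x' y; rewrite coeffD coeffZ scalerDl scalerA.
  by move=> a x y y'; rewrite scalerDr !scalerA mulrC.
exists c; split=> // z.
(* The expansion is required over every larger duplicate-free list, so that two elements can be
   expanded over a common list and added. *)
pose P z := exists s : seq K, forall s', uniq s' -> {subset s <= s'} ->
  z = \sum_(k <- s') tens << k >> (c k z).
have Psub : is_submod P.
  split=> [|a u v [s hs] [t ht]].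
    by exists [::] => s' _ _; rewrite big1 // => k _; rewrite linear0 tens0r.
  exists (s ++ t) => s' us' ss'.
  have eu : u = \sum_(k <- s') tens << k >> (c k u).
    by apply: hs => // k ks; apply: ss'; rewrite mem_cat ks.
  have ev : v = \sum_(k <- s') tens << k >> (c k v).
    by apply: ht => // k ks; apply: ss'; rewrite mem_cat ks orbT.
  apply: etrans (congr2 (fun x y => a *: x + y) eu ev) _.
  rewrite scaler_sumr -big_split; apply: eq_bigr => k _ /=.
  by rewrite linearP tens_linearr.
suff /(mem_mk_submod Psub) [s hs] : z \in mk_submod Psub.
  by exists (undup s); apply: hs => [|k]; rewrite ?undup_uniq ?mem_undup.
apply: tensor_gen => p y.
have [f fE] : exists f : {linear {freeg K / R} -> tensor {freeg K / R} N}, forall p, f p = tens p y.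
  have fl : linear (fun p : {freeg K / R} => tens p y) by move=> a u v; apply: tens_linearl.
  pose f : {linear {freeg K / R} -> tensor {freeg K / R} N} :=
    HB.pack (fun p : {freeg K / R} => tens p y) (GRing.isLinear.Build R _ _ *:%R _ fl).
  by exists f.
rewrite -fE -mem_preim; apply: freeg_gen => k; rewrite mem_preim fE.
apply/(mem_mk_submod Psub); exists [:: k] => s' us' ks'.
rewrite (bigD1_seq k) ?ks' ?inE //= cE coeffU eqxx mulr1 scale1r big1 ?addr0 // => k' /negbTE kk'.
by rewrite cE coeffU eq_sym kk' mulr0 scale0r tens0r.
Qed.

Lemma free_coordr (K : choiceType) (N : lmodType R) :
  exists c : K -> {linear tensor N {freeg K / R} -> N},
    (forall k p y, c k (tens y p) = coeff k p *: y) /\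
    forall z, exists s : seq K, z = \sum_(k <- s) tens (c k z) << k >>.
Proof.
have [c [cE cS]] := free_coordl K N.
have [w wE] := tens_swap N {freeg K / R}; have [w' w'E] := tens_swap {freeg K / R} N.
exists (fun k => c k \o w); split=> [k p y|z]; first by rewrite /= wE cE.
have [s e] := cS (w z); exists s.
have ww : w' (w z) = z by apply: (tensor_ext (h := w' \o w) (k := idfun)) => x y; rewrite /= wE w'E.
rewrite -{1}ww; apply: etrans (congr1 w' e) _.
by rewrite linear_sum; apply: eq_bigr => k _; rewrite /= w'E.
Qed.

(** Flatness of free modules. The maps p and q are identities only pointwise because [res_map idfun]
    is the identity only up to extensionality. *)
Lemma tensmap_short_exact (K : choiceType) (N1 N2 N3 : lmodType R)
    (f : {linear N1 -> N2}) (g : {linear N2 -> N3})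
    (p q : {linear {freeg K / R} -> {freeg K / R}}) :
  p =1 idfun -> q =1 idfun ->
  short_exact f g -> short_exact (tensmap p f) (tensmap q g).
Proof.
move=> pE qE [f_inj g_surj fg].
have [c1 [c1E c1S]] := free_coordl K N1; have [c2 [c2E c2S]] := free_coordl K N2.
have [c3 [c3E c3S]] := free_coordl K N3.
have nf k z : c2 k (tensmap p f z) = f (c1 k z).
  apply: (tensor_ext (h := c2 k \o tensmap p f) (k := f \o c1 k)) => x y.
  rewrite -[LHS]/(c2 k (tensmap p f (tens x y))) -[RHS]/(f (c1 k (tens x y))).
  by rewrite tensmapE c2E c1E pE linearZ.
have ng k z : c3 k (tensmap q g z) = g (c2 k z).
  apply: (tensor_ext (h := c3 k \o tensmap q g) (k := g \o c2 k)) => x y.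
  rewrite -[LHS]/(c3 k (tensmap q g (tens x y))) -[RHS]/(g (c2 k (tens x y))).
  by rewrite tensmapE c3E c2E qE linearZ.
split.
- apply: linear_inj => z fz; have [s ->] := c1S z; rewrite big1 // => k _.
  by rewrite (f_inj (c1 k z) 0) ?tens0r // -nf fz !linear0.
- move=> z; have [s ->] := c3S z; have /choice [h hE] := g_surj.
  exists (\sum_(k <- s) tens << k >> (h (c3 k z))); rewrite linear_sum.
  by apply: eq_bigr => k _; rewrite tensmapE qE hE.
- move=> z; split=> [gz|[y <-]].
    have [s e] := c2S z.
    have /choice [h hE] : forall k, exists y, f y = c2 k z.
      by move=> k; apply/fg; rewrite -ng gz linear0.
    exists (\sum_(k <- s) tens << k >> (h k)); rewrite linear_sum [RHS]e.
    by apply: eq_bigr => k _; rewrite tensmapE pE hE.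
  have [s ->] := c1S y; rewrite !linear_sum big1 // => k _.
  rewrite !tensmapE (_ : g _ = 0) ?tens0r //; apply/fg; by eexists.
Qed.

(** Flatness in the other argument: tensoring the resolution with a free module keeps it exact,
    whence the vanishing in [Tor_free]. *)
Lemma tensmap_free_exact (K : choiceType) (A1 A2 A3 : lmodType R)
    (u : {linear A1 -> A2}) (v : {linear A2 -> A3}) (z : tensor A2 {freeg K / R}) :
  (forall x, v x = 0 -> exists y, u y = x) ->
  tensmap v (idfun : {linear {freeg K / R} -> _}) z = 0 ->
  exists w, z = tensmap u (idfun : {linear {freeg K / R} -> _}) w.
Proof.
move=> uv vz.
have [c2 [c2E c2S]] := free_coordr K A2; have [c3 [c3E _]] := free_coordr K A3.
have nv k y : c3 k (tensmap v idfun y) = v (c2 k y).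
  apply: (tensor_ext (h := c3 k \o tensmap v idfun) (k := v \o c2 k)) => x p.
  rewrite -[LHS]/(c3 k (tensmap v idfun (tens x p))) -[RHS]/(v (c2 k (tens x p))).
  by rewrite tensmapE c3E c2E linearZ.
have [s e] := c2S z.
have /choice [h hE] : forall k, exists y, u y = c2 k z.
  by move=> k; apply: uv; rewrite -nv vz linear0.
exists (\sum_(k <- s) tens (h k) << k >>); rewrite linear_sum [LHS]e.
by apply: eq_bigr => k _; rewrite tensmapE hE.
Qed.

End FreeTensor.

Section TorFacts.
Variable R : comNzRingType.
Implicit Types A N : lmodType R.

Lemma aug_exact A n (x : {freeg (syzygy n A) / R}) : aug (syzygy n A) x = 0 ->
  exists y, res_bdry A n y = x.
Proof.
move=> /(mem_mk_submod (ker_submod (aug (syzygy n A)))) xk.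
by exists << (Submod xk : syzygy n.+1 A) >>; rewrite /res_bdry /= /aug fglift1.
Qed.

Lemma res_exact A n x : res_bdry A n x = 0 -> exists y, res_bdry A n.+1 y = x.
Proof. by move=> x0; apply: (@aug_exact A n.+1); apply: val_inj; apply: x0. Qed.

Lemma res_map_id A n : @res_map R A A idfun n =1 idfun.
Proof.
have id_syz k : @syzygy_map R A A idfun k =1 idfun.
  elim: k => //= k IH x; apply: val_inj.
  apply: (freeg_ext (f := freemap R (@syzygy_map R A A idfun k)) (g := idfun)) => j.
  by rewrite -[LHS]/(freemap _ _ _) freemap1 IH.
apply: (freeg_ext (f := @res_map R A A idfun n) (g := idfun)) => k.
by rewrite -[LHS]/(freemap _ _ _) freemap1 id_syz.
Qed.

Definition tor_chain_map A A' N N' (p : {linear A -> A'}) (f : {linear N -> N'}) :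
  chain_map (tor_complex A N) (tor_complex A' N') := ChainMap (tor_cmap_bdry p f).

Lemma tor_short_exact A N1 N2 N3 (f : {linear N1 -> N2}) (g : {linear N2 -> N3}) n :
  short_exact f g -> short_exact (tor_chain_map (idfun : {linear A -> A}) f n)
                                 (tor_chain_map (idfun : {linear A -> A}) g n).
Proof. by apply: tensmap_short_exact; apply: res_map_id. Qed.

Definition tor_connecting A N1 N2 N3 (f : {linear N1 -> N2}) (g : {linear N2 -> N3}) i
    (c : Tor A N3 i.+1) (a : Tor A N1 i) : Prop :=
  connecting (tor_chain_map idfun f) (tor_chain_map idfun g) c a.

Lemma tor_chain_map_square A A' N1 N2 N1' N2' (r : {linear A -> A'})
    (f : {linear N1 -> N2}) (f' : {linear N1' -> N2'})
    (p : {linear N1 -> N1'}) (q : {linear N2 -> N2'}) n x :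
  (forall y, f' (p y) = q (f y)) ->
  tor_chain_map (idfun : {linear A' -> A'}) f' n (tor_chain_map r p n x) =
  tor_chain_map r q n (tor_chain_map (idfun : {linear A -> A}) f n x).
Proof.
move=> fp; rewrite -[LHS]/(tensmap _ _ (tensmap _ _ x)) -[RHS]/(tensmap _ _ (tensmap _ _ x)).
rewrite !tensmap_comp; apply: tensmap_eq => y; last exact: fp.
by apply: etrans (res_map_id _) _; congr (res_map r n _); apply/esym/res_map_id.
Qed.

Lemma tor_connecting_map A A' N1 N2 N3 N1' N2' N3'
    (f : {linear N1 -> N2}) (g : {linear N2 -> N3})
    (f' : {linear N1' -> N2'}) (g' : {linear N2' -> N3'}) (r : {linear A -> A'})
    (p1 : {linear N1 -> N1'}) (p2 : {linear N2 -> N2'}) (p3 : {linear N3 -> N3'}) i c a :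
  (forall x, f' (p1 x) = p2 (f x)) -> (forall x, g' (p2 x) = p3 (g x)) ->
  tor_connecting (A := A) f g (i := i) c a ->
  tor_connecting f' g' (Tor_map r p3 i.+1 c) (Tor_map r p1 i a).
Proof.
by move=> fp gp; apply: connecting_map => n z; apply: tor_chain_map_square.
Qed.

Lemma Tor_map_comp A N1 N2 N3 (f : {linear N1 -> N2}) (g : {linear N2 -> N3})
    (h : {linear N1 -> N3}) i (z : Tor A N1 i) :
  (forall x, g (f x) = h x) ->
  Tor_map idfun g i (Tor_map idfun f i z) = Tor_map idfun h i z.
Proof.
move=> gf; apply: homology_map_comp => n x; apply: etrans (tensmap_comp _ _ _ _ _) _.
by apply: tensmap_eq => y; [rewrite /= !res_map_id | apply: gf].
Qed.

Lemma Tor_map_scale A N (f : {linear N -> N}) (a : R) i (z : Tor A N i) :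
  (forall x, f x = a *: x) -> Tor_map idfun f i z = a *: z.
Proof.
move=> fa; have [x zx] := represents_ex z.
apply: (represents_uniq (x := a *: x)); last exact: representsZ.
have -> : a *: x = tor_chain_map (idfun : {linear A -> A}) f i x.
  apply: (tensor_ext (h := scalemap _ a) (k := tensmap (res_map idfun i) f)) => u v.
  rewrite -[RHS]/(tensmap (res_map idfun i) f (tens u v)).
  by rewrite tensmapE fa res_map_id tensZr.
exact: (represents_map (tor_chain_map idfun f)).
Qed.

Lemma Tor_map_id A N (f : {linear N -> N}) i (z : Tor A N i) :
  (forall x, f x = x) -> Tor_map idfun f i z = z.
Proof. by move=> fE; rewrite (@Tor_map_scale _ _ _ 1) ?scale1r // => x; rewrite scale1r. Qed.

Lemma Tor_free A (K : choiceType) i (z : Tor A {freeg K / R} i.+1) : z = 0.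
Proof.
have [x zx] := represents_ex z; apply/(represents_eq0 zx).
exact: (tensmap_free_exact (@res_exact A i) (represents_cycle zx)).
Qed.

Lemma kernel_short_exact N1 N2 (f : {linear N1 -> N2}) : (forall y, exists x, f x = y) ->
  short_exact (@submod_val R N1 (mk_submod (ker_submod f))) f.
Proof.
move=> f_surj; split=> // [|b]; first exact: submod_val_inj.
split=> [/(mem_mk_submod (ker_submod f)) bk|[a <-]]; first by exists (Submod bk).
exact/(mem_mk_submod (ker_submod f))/submodP.
Qed.

Lemma quotient_short_exact N (T : submodClosed N) : short_exact (@submod_val R N T) (qproj T).
Proof.
split=> [|c|b]; [exact: submod_val_inj | exact: qproj_surj |].
split=> [/qproj_eq0 bT|[a <-]]; first by exists (Submod bT).
by apply/qproj_eq0/submodP.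
Qed.

(** Dimension shifting in the second argument, the one not resolved in the definition of Tor: the
    connecting map is injective because the free middle term has no higher Tor. *)
Lemma tor_shift A N1 N3 (K : choiceType) (f : {linear N1 -> {freeg K / R}})
    (g : {linear {freeg K / R} -> N3}) i : short_exact f g ->
  exists d : {linear Tor A N3 i.+1 -> Tor A N1 i},
    injective d /\ forall c, tor_connecting f g c (d c).
Proof.
move=> fg; have se n := tor_short_exact A n fg.
have [d dP] := linear_of_relation (connecting_total se (i := i)) (connecting0 se (i := i))
  (fun u x y v w => @connecting_lin _ _ _ _ _ _ i u x y v w).
exists d; split=> //; apply: linear_inj => c dc0.
have := dP c; rewrite dc0 => /(connecting_exact_right se) [b <-].
by rewrite [b]Tor_free linear0.
Qed.

(** * Tor with first argument R/J *)

Section TorQuotient.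
Variable J : submodClosed R^o.
Let A : lmodType R := quotmod J.
Let e : {freeg A / R} := << qproj J 1 >>.

(** Degree 0 of the resolution is free on all elements of R/J. A basis element k differs from a
    multiple of e, the basis element of the class of 1, by an element of the augmentation kernel,
    hence by a boundary. *)
Lemma tor0_surj N (h : Tor A N 0) : exists y, represents h (tens e y).
Proof.
have [z hz] := represents_ex h.
pose B := tor_complex A N.
have [y [w zE]] : exists y w, z - tens e y = bdry B 0 w.
  pose P (z : B 0) := exists y w, z - tens e y = bdry B 0 w.
  have Psub : is_submod P.
    split=> [|a u v [y [w uE]] [y' [w' vE]]].
      by exists 0, 0; rewrite tens0r linear0 subrr.
    exists (a *: y + y'), (a *: w + w').
    apply/esym; apply: etrans (linearP (bdry B 0) a w w') _.
    apply: etrans (congr2 (fun x y => a *: x + y) (esym uE) (esym vE)) _.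
    by rewrite tens_linearr scalerBr opprD addrACA.
  apply/(mem_mk_submod Psub); apply: tensor_gen => p y.
  have fl : linear (fun p : {freeg A / R} => tens p y : B 0) by move=> a u v; apply: tens_linearl.
  pose f : {linear {freeg A / R} -> B 0} := HB.pack (fun p : {freeg A / R} => tens p y : B 0)
    (GRing.isLinear.Build R _ _ *:%R _ fl).
  rewrite -[tens p y]/(f p) -mem_preim; apply: freeg_gen => k; rewrite mem_preim.
  apply/(mem_mk_submod Psub).
  have [|q qE] := @aug_exact A 0 (<< k >> - qrepr k *: e).
    rewrite linearB linearZ /= /aug !fglift1 -linearZ /=.
    by rewrite -[X in X - _]qreprK -linearB; apply/qproj_eq0; rewrite [_ *: _]mulr1 subrr rpred0.
  exists (qrepr k *: y), (tens q y).
  by rewrite tensZr -tensZl -tensBl -qE /= [RHS]tensmapE.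
exists y; have [h' h'e] := @represents_of_cycle R B 0 (tens e y) I.
suff -> : h = h' by [].
apply/eqP; rewrite -subr_eq0; apply/eqP/(represents_eq0 (representsB hz h'e)).
by exists w.
Qed.

Lemma tor0_map N : exists phi : {linear N -> Tor A N 0}, forall y, represents (phi y) (tens e y).
Proof.
apply: (@linear_of_relation R N (Tor A N 0)
  (fun y h => @represents R (tor_complex A N) 0 h (tens e y))) => [x|h|a x y u v hu hv].
- exact: (@represents_of_cycle R (tor_complex A N) 0).
- by rewrite tens0r => /represents_uniq; apply; apply: represents0.
- by rewrite tens_linearr; apply: represents_lin.
Qed.

(** The identification of Tor_0(R/J, N) with N/JN, in terms of the representatives of
    [tor0_surj]. *)
Lemma tor0_eq0 N (h : Tor A N 0) y : represents h (tens e y) -> h = 0 <-> y \in smul J N.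
Proof.
move=> hy; split.
  move=> /(represents_eq0 hy) [w yE].
  (* A lift of the augmentation to R through chosen representatives. Then [psi] sends p tensor x to
     rho(p) x modulo JN, kills boundaries, and maps e tensor y to the class of y since rho(e) is 1
     modulo J. *)
  pose rho : {linear {freeg A / R} -> R^o} := fglift (@qrepr R R^o J).
  have rhoE p : qproj J (rho p) = aug A p.
    apply: (freeg_ext (f := qproj J \o rho) (g := aug A)) => k.
    by rewrite /= /rho /aug !fglift1 qreprK.
  have [psi psiE] : exists psi : {linear tensor {freeg A / R} N -> quotmod (smul J N)},
      forall p x, psi (tens p x) = qproj _ ((rho p : R) *: x).
    apply: (tens_lift (h := fun (p : {freeg A / R}) (x : N) =>
        qproj (smul J N) ((rho p : R) *: x))).
      move=> a p p' x; rewrite -linearP; congr qproj.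
      by rewrite linearP scalerDl scalerA.
    move=> a p x x'; rewrite -linearP; congr qproj.
    by rewrite scalerDr !scalerA mulrC.
  have psi0 v : psi (tor_bdry A N 0 v) = 0.
    apply: (tensor_ext (h := psi \o tor_bdry A N 0) (k := GRing.Linear.clone _ _ _ _ \0 _)) => p x.
    rewrite -[LHS]/(psi (tensmap (bdry (resolution A) 0) idfun (tens p x))).
    rewrite tensmapE psiE; apply/qproj_eq0/mem_smul/qproj_eq0.
    rewrite rhoE /= /res_bdry /=.
    exact/(mem_mk_submod (ker_submod (aug A)))/submodP.
  apply/qproj_eq0.
  have : psi (tens e y) = 0 by rewrite yE psi0.
  have rhoe : rho e = qrepr (qproj J 1) by apply: fglift1.
  rewrite psiE rhoe => e0; rewrite -[RHS]e0; apply/qproj_eq.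
  rewrite -{1}[y]scale1r -scalerBl; apply: mem_smul; apply/qproj_eq.
  by rewrite qreprK.
have [phi phiE] := tor0_map N.
have phi0 : {subset smul J N <= preim_submod phi (zero_submod _)}.
  apply: smul_sub => a v aJ; rewrite mem_preim; apply/mem_zero.
  apply/(represents_eq0 (phiE _)).
  have [|q qE] := @aug_exact A 0 (a *: e).
    rewrite linearZ /= /aug fglift1 -linearZ /=; apply/qproj_eq0.
    by rewrite [_ *: _]mulr1.
  exists (tens q v); rewrite tensZr -tensZl -qE /=.
  by rewrite [RHS]tensmapE.
move=> /phi0; rewrite mem_preim => /mem_zero y0; rewrite -y0.
exact: represents_uniq hy (phiE y).
Qed.

(** Clear in degree 0 from N/JN; higher Tor embeds into lower Tor of a kernel by dimension
    shifting. *)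
Lemma tor_killed N i (h : Tor A N i) (a : R) : a \in J -> a *: h = 0.
Proof.
elim: i N h => [|i IH] N h aJ.
  have [y hy] := tor0_surj h.
  have := representsZ a hy; rewrite -tensZr => /tor0_eq0 [_]; apply.
  exact: mem_smul.
have [|d [d_inj _]] := @tor_shift A (augker N) N N (@submod_val R _ _) (aug N) i.
  by apply: kernel_short_exact => y; exists << y >>; apply: fglift1.
apply: d_inj; apply: etrans (linearZ_LR d a h) _.
by rewrite [LHS](IH _ (d h) aJ) linear0.
Qed.

(** Finiteness is drawn from a finite free cover of N rather than from the functorial resolution,
    whose terms are free on all elements of a module. *)
Lemma tor_noetherian N i : noetherian R^o -> noetherian N -> noetherian (Tor A N i).
Proof.
move=> nR; elim: i N => [|i IH] N nN.
  have [phi phiE] := tor0_map N; apply: (noetherian_surj (f := phi)) nN => h.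
  have [y hy] := tor0_surj h; exists y; exact: represents_uniq (phiE y) hy.
have [n [f f_surj]] := noetherian_cover nN.
have [d [d_inj _]] := tor_shift A i (kernel_short_exact f_surj).
apply: (noetherian_inj d_inj); apply: IH; apply: noetherian_submod.
exact: noetherian_freeg.
Qed.

End TorQuotient.
End TorFacts.

(** * Inverse systems of Tor modules *)

Section InverseSystems.
Variable R : comNzRingType.
Implicit Types X : inv_system R.

(** The image in X n of E at stage n + d, taken one transition at a time to avoid casts between
    stages. *)
Fixpoint iter_image X (E : forall n, X n -> Prop) d : forall n, X n -> Prop :=
  if d is k.+1 then fun n x => exists2 y, iter_image E k y & inv_step X n y = x else E.

(* The Mittag-Leffler condition holds since the directions of the affine sets *)
(* iter_image E d n form, for fixed n, a descending chain of submodules.      *)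
Lemma affine_thread X (E : forall n, X n -> Prop) :
  (forall n, artinian (X n)) -> (forall n, exists x, E n x) ->
  (forall n (a : R) x y z, E n x -> E n y -> E n z -> E n (x + a *: (y - z))) ->
  (forall n x, E n.+1 x -> E n (inv_step X n x)) ->
  exists t : prodmod X, is_thread t /\ forall n, E n (t n).
Proof.
move=> aX exE affE stepE.
have exI d n : exists x, iter_image E d (n := n) x.
  by elim: d n => [|d IH] n //=; have [y Iy] := IH n.+1; exists (inv_step X n y), y.
have affI d n (a : R) (x y z : X n) : iter_image E d x -> iter_image E d y -> iter_image E d z ->
    iter_image E d (x + a *: (y - z)).
  elim: d n x y z => [|d IH] n x y z /=; first exact: affE.
  move=> [x' Ix <-] [y' Iy <-] [z' Iz <-]; exists (x' + a *: (y' - z')); first exact: IH.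
  by rewrite linearD linearZ linearB.
have decI d n (x : X n) : iter_image E d.+1 x -> iter_image E d x.
  elim: d n x => [|d IH] n x; first by move=> [y Ey <-]; apply: stepE.
  by move=> [y /IH Iy <-]; exists y.
have decI' d k n (x : X n) : (k <= d)%N -> iter_image E d x -> iter_image E k x.
  by move=> /subnK <-; elim: (d - k)%N => // e IH; rewrite addSn => /decI /IH.
have stab n : exists k, forall (x : X n), iter_image E k x -> forall d, iter_image E d x.
  pose dir d (u : X n) := exists x y, [/\ iter_image E d x, iter_image E d y & u = x - y].
  have dirP d : is_submod (dir d).
    split=> [|a u v [x [y [Ix Iy ->]]] [x' [y' [Ix' Iy' ->]]]].
      by have [x Ix] := exI d n; exists x, x; rewrite subrr.
    exists (x' + a *: (x - y)), y'; split=> //; first exact: affI.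
    by rewrite addrA [_ + x']addrC.
  have [d x|k hk] := aX n (fun d => mk_submod (dirP d)).
    move=> /mem_mk_submod [u [v [Iu Iv ->]]]; apply/mem_mk_submod.
    by exists u, v; split=> //; apply: decI.
  exists k => x Ix d; have [dk|kd] := leqP d k; first exact: decI' Ix.
  (* A point y of the smaller d-th image differs from x by a direction of the k-th image; directions
     being stable, x lies in the d-th image too. *)
  have [y Iy] := exI d n.
  have : x - y \in mk_submod (dirP k).
    apply/mem_mk_submod; exists x, y; split=> //; exact: decI' (ltnW kd) Iy.
  rewrite -(hk d) ?(ltnW kd) // => /mem_mk_submod [u [v [Iu Iv e]]].
  have -> : x = y + 1 *: (u - v) by rewrite scale1r -e addrCA subrr addr0.
  exact: affI.
pose S n := {x : X n | forall d, iter_image E d x}.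
have s0 : S 0%N.
  apply: cid; have [k hk] := stab 0%N; have [x Ix] := exI k 0%N.
  by exists x; apply: hk.
have next n (s : S n) : {s' : S n.+1 | inv_step X n (sval s') = sval s}.
  apply: cid; case: s => x Sx /=; have [k hk] := stab n.+1.
  by have [y Iy yx] := Sx k.+1; exists (exist _ y (hk y Iy)).
pose t : forall n, S n := nat_rect S s0 (fun n s => sval (next n s)).
exists (fun n => sval (t n)); split=> n; last exact: (svalP (t n) 0%N).
exact: (svalP (next n (t n))).
Qed.

Lemma thread_iter_image X (t : prodmod X) d n :
  is_thread t -> iter_image (fun _ _ => True) d (t n).
Proof. by move=> tt; elim: d n => [|d IH] n //=; exists (t n.+1); [apply: IH | apply: tt]. Qed.

End InverseSystems.

(** * The modules Tor(R/m^s, N) for artinian and for noetherian N *)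

Section LocalTor.
Variables (R : comNzRingType) (m : submodClosed R^o).
Hypotheses (nR : noetherian R^o) (m_max : maximal_ideal m).
Implicit Types N C : lmodType R.

Lemma tor_noetherian_artinian C i s : noetherian C -> artinian (Tor (quot_exp m s) C i).
Proof.
move=> nC; apply: (artinian_of_killed m_max (s := s)); first exact: tor_noetherian.
by move=> a v am; apply: tor_killed.
Qed.

(** If T is proper, Tor of N is caught between Tor of T and Tor of the noetherian module N/T. If x N
    = N, the kernel of x on E = Tor_i(R/m^s, N) is the image of Tor_i of L = 0 :_N x, hence artinian
    by induction; so are the kernels of all x^j, and x^s kills E. *)
Lemma tor_artinian N i s : artinian N -> artinian (Tor (quot_exp m s) N i).
Proof.
move: N; apply: artinian_ind => N aN IH; set A := quot_exp m s.
have [T [k [x [nT kT xm xT]]]] := artinian_stable_part nR m_max aN.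
have [prop|full] := EM (exists v, v \notin T).
  have se n := tor_short_exact A n (quotient_short_exact T).
  apply: (artinian_exact (homology_exact se (n := i))); first exact: IH.
  exact: tor_noetherian_artinian.
have {xT full} x_surj y : exists z, scalemap N x z = y.
  have [|z _ <-] := xT y; last by exists z.
  by apply: contrapT => /negP yT; apply: full; exists y.
pose L := mk_submod (ker_submod (scalemap N x)).
have [prop|full] := EM (exists v, v \notin L); last first.
  apply: tor_noetherian_artinian; apply: noetherian_trivial => y.
  have [z <-] := x_surj y; apply/(mem_mk_submod (ker_submod (scalemap N x))).
  by apply: contrapT => /negP zL; apply: full; exists z.
have se n := tor_short_exact A n (kernel_short_exact x_surj).
pose E := Tor A N i; pose f := Tor_map (idfun : {linear A -> A}) (@submod_val R N L) i.
have fE (h : E) : x *: h = 0 -> exists a, f a = h.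
  by rewrite -(@Tor_map_scale _ A N (scalemap N x) x) // => /(homology_exact se).
have xf a : x *: f a = 0.
  have xa : x *: a = 0.
    have xL (y : submod L) : scalemap (submod L) x y = x *: y by [].
    have x0 (y : submod L) : scalemap (submod L) x y = (0 : R) *: y.
      rewrite scale0r scalemapE; apply: val_inj.
      exact/(mem_mk_submod (ker_submod (scalemap N x)))/submodP.
    by rewrite -(Tor_map_scale a xL) (Tor_map_scale a x0) scale0r.
  by apply: etrans (esym (linearZ_LR f x a)) _; rewrite xa; apply: (linear0 f).
pose K j := mk_submod (ker_submod (scalemap E (x ^+ j))).
have memK j h : h \in K j <-> x ^+ j *: h = 0.
  exact: (mem_mk_submod (ker_submod (scalemap E (x ^+ j)))).
have aK j : artinian (submod (K j)).
  elim: j => [|j aKj].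
    apply: artinian_trivial => h; apply: val_inj.
    by have /memK := submodP h; rewrite scale1r.
  have [|a|p pE] := @linear_factor R (Tor A (submod L) i) (submod (K j.+1)) E f (@submod_val R E _).
  - exact: submod_val_inj.
  - have fK : f a \in K j.+1 by apply/memK; rewrite exprSr -scalerA xf scaler0.
    by exists (Submod fK).
  have [|a|q qE] := @linear_factor R (submod (K j.+1)) (submod (K j)) E
      (scalemap E x \o @submod_val R E (K j.+1)) (@submod_val R E (K j)).
  - exact: submod_val_inj.
  - have xK : x *: submod_val a \in K j by apply/memK; rewrite scalerA -exprSr; apply/memK/submodP.
    by exists (Submod xK).
  apply: (@artinian_exact _ _ _ _ p q _ _ aKj); last exact: IH prop.
  move=> y qy0; have [|a fa] := fE (submod_val y).
    by have := qE y; rewrite qy0 linear0 => /esym.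
  by exists a; apply: val_inj; rewrite [LHS]pE.
apply: (@artinian_surj _ _ _ (@submod_val R E (K s))) (aK s) => h.
have hK : h \in K s by apply/memK/tor_killed; apply: mem_expX.
by exists (Submod hK).
Qed.

Lemma tor_connecting_step N1 N2 N3 (f : {linear N1 -> N2}) (g : {linear N2 -> N3}) i n
    (c : Tor (quot_exp m n.+1) N3 i.+1) (a : Tor (quot_exp m n.+1) N1 i) :
  tor_connecting f g c a ->
  tor_connecting f g (inv_step (tor_system m i.+1 N3) n c) (inv_step (tor_system m i N1) n a).
Proof.
exact: (@tor_connecting_map R _ _ N1 N2 N3 N1 N2 N3 f g f g (quot_exp_step m n)
  idfun idfun idfun).
Qed.

Lemma tor_iter_image C (K : choiceType) (N : lmodType R)
    (f : {linear N -> {freeg K / R}}) (g : {linear {freeg K / R} -> C}) i d n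
    (c : Tor (quot_exp m n) C i.+1) : short_exact f g ->
  iter_image (X := tor_system m i.+1 C) (fun _ _ => True) d (n := n) c ->
  exists w, iter_image (X := tor_system m i N) (fun _ _ => True) d (n := n) w /\
    tor_connecting f g c w.
Proof.
move=> fg; elim: d n c => [|d IH] n c.
  move=> _; have [w cw] := connecting_total (fun k => tor_short_exact (quot_exp m n) k fg) c.
  by exists w.
move=> [c' /IH [w' [Iw' cw']] <-]; exists (Tor_map (quot_exp_step m n) idfun i w'); split.
  by exists w'.
exact: tor_connecting_step.
Qed.

(** With F the free module and N the kernel, Tor_1(R/m^k, C) is (N cap m^k F)/m^k N. A class coming
    from stage d + n thus has a representative y in m^(d+n) F. *)
Lemma tor1_iter_image C (K : choiceType) (N : lmodType R)
    (f : {linear N -> {freeg K / R}}) (g : {linear {freeg K / R} -> C}) d n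
    (c : Tor (quot_exp m n) C 1) : short_exact f g ->
  iter_image (X := tor_system m 1 C) (fun _ _ => True) d (n := n) c ->
  exists w y, [/\ tor_connecting f g c w,
    represents (C := tor_complex (quot_exp m n) N) w
      (tens << qproj (ideal_exp m n) (1 : R^o) >> y) &
    f y \in smul (ideal_exp m (d + n)) {freeg K / R}].
Proof.
move=> fg; elim: d n c => [|d IH] n c.
  move=> _; have se k := tor_short_exact (quot_exp m n) k fg.
  have [w cw] := connecting_total se c; have [y wy] := tor0_surj w.
  exists w, y; split=> //.
  have [b [x [fx cb wx]]] := cw.
  have : homology_map (tor_chain_map (idfun : {linear quot_exp m n -> _}) f) 0 w = 0.
    by apply/(represents_eq0 (represents_map _ wx)); exists b.
  have := represents_map (tor_chain_map (idfun : {linear quot_exp m n -> _}) f) wy.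
  by rewrite [X in represents _ X]tensmapE res_map_id => /tor0_eq0 [h _] /h.
move=> [c' /IH [w' [y [cw' wy fy]]] <-].
exists (Tor_map (quot_exp_step m n) idfun 0 w'), y; split; last by rewrite addSnnS.
  exact: tor_connecting_step.
have := represents_map (tor_chain_map (quot_exp_step m n) idfun) wy.
rewrite [X in represents _ X]tensmapE.
have -> : res_map (quot_exp_step m n) 0 << qproj (ideal_exp m n.+1) (1 : R^o) >> =
    << qproj (ideal_exp m n) (1 : R^o) >>.
  by rewrite [LHS]freemap1 [syzygy_map _ _ _]quotmapE.
by [].
Qed.

(** In degree 1, Artin-Rees puts N cap m^(d+n) F inside m^n N for large d, so the transition from
    stage d + n is zero. Higher degrees follow by dimension shifting, which respects the transition
    maps. *)
Lemma tor_prozero C i n : noetherian C ->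
  exists d, forall c : Tor (quot_exp m n) C i.+1,
    iter_image (X := tor_system m i.+1 C) (fun _ _ => True) d (n := n) c -> c = 0.
Proof.
elim: i C n => [|i IH] C n nC; have [k [g g_surj]] := noetherian_cover nC;
  have fg := kernel_short_exact g_surj.
  have [|t ht] := @artin_rees R _ _ _ m n nR _ (@submod_val_inj R _ (mk_submod (ker_submod g))).
    exact: noetherian_freeg.
  exists t => c /(tor1_iter_image fg) [w [y [cw wy fy]]].
  have w0 : w = 0.
    apply/(tor0_eq0 wy)/ht; move: fy; apply: smul_sub => a v am; apply: mem_smul.
    by apply: exp_le am; rewrite leq_addr.
  move: cw; rewrite w0 => cw.
  have [b <-] := connecting_exact_right (fun k => tor_short_exact (quot_exp m n) k fg) cw.
  by rewrite [b]Tor_free linear0.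
have [|d hd] := IH (submod (mk_submod (ker_submod g))) n.
  exact/noetherian_submod/noetherian_freeg.
exists d => c /(tor_iter_image fg) [w [/hd -> cw]].
have [b <-] := connecting_exact_right (fun k => tor_short_exact (quot_exp m n) k fg) cw.
by rewrite [b]Tor_free linear0.
Qed.

End LocalTor.

(** * Local homology and direct limits *)

Section LocalHomologySequence.
Variables (R : comNzRingType) (m : submodClosed R^o).
Hypotheses (nR : noetherian R^o) (m_max : maximal_ideal m).
Implicit Types N : lmodType R.

Lemma local_homology_ext i N (z w : local_homology m i N) :
  (forall n, submod_val z n = submod_val w n) -> z = w.
Proof. by move=> zw; apply: val_inj; apply: functional_extensionality_dep. Qed.

Lemma local_homology_thread i N (z : local_homology m i N) : is_thread (submod_val z).
Proof. exact/(mem_mk_submod (@is_thread_submod R (tor_system m i N)))/submodP. Qed.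

Lemma local_homology_of_thread i N (t : prodmod (tor_system m i N)) : is_thread t ->
  exists z : local_homology m i N, forall n, submod_val z n = t n.
Proof.
by move=> /(mem_mk_submod (@is_thread_submod R (tor_system m i N))) tt; exists (Submod tt).
Qed.

Lemma local_homology_map_comp i N1 N2 N3 (f : {linear N1 -> N2}) (g : {linear N2 -> N3})
    (h : {linear N1 -> N3}) (z : local_homology m i N1) : (forall x, g (f x) = h x) ->
  local_homology_map m i g (local_homology_map m i f z) = local_homology_map m i h z.
Proof. by move=> gf; apply: local_homology_ext => n; apply: Tor_map_comp. Qed.

Lemma local_homology_map_scale i N (f : {linear N -> N}) (a : R) (z : local_homology m i N) :
  (forall x, f x = a *: x) -> local_homology_map m i f z = a *: z.
Proof. by move=> fa; apply: local_homology_ext => n; apply: Tor_map_scale. Qed.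

Lemma local_homology_map_id i N (f : {linear N -> N}) (z : local_homology m i N) :
  (forall x, f x = x) -> local_homology_map m i f z = z.
Proof. by move=> fE; apply: local_homology_ext => n; apply: Tor_map_id. Qed.

Lemma local_homology_noetherian i N (z : local_homology m i.+1 N) : noetherian N -> z = 0.
Proof.
move=> nN; apply: local_homology_ext => n; have [d hd] := tor_prozero m nR i n nN.
by apply: hd; apply: thread_iter_image; apply: local_homology_thread.
Qed.

Section ShortExact.
Variables (A B C : lmodType R) (f : {linear A -> B}) (g : {linear B -> C}).
Hypothesis fg : short_exact f g.
Let se n k := tor_short_exact (quot_exp m n) k fg.

(** The connecting homomorphism is kept as a relation that holds at every stage of the inverse
    system. *)
Definition local_homology_connecting i (c : local_homology m i.+1 C) (a : local_homology m i A) :=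
  forall n, tor_connecting f g (submod_val c n) (submod_val a n).

(** At each stage the preimages of b form a nonempty coset of a submodule of an artinian Tor module;
    [affine_thread] chooses them compatibly. *)
Lemma local_homology_exact i (b : local_homology m i B) : artinian A ->
  local_homology_map m i g b = 0 -> exists a, local_homology_map m i f a = b.
Proof.
move=> aA gb; pose E n (a : tor_system m i A n) := Tor_map idfun f i a = submod_val b n.
have [n|n|n a x y z|n a|t [tt tE]] := @affine_thread R (tor_system m i A) E.
- exact: tor_artinian.
- apply: (homology_exact (se n)).
  by have := congr1 (fun z : local_homology m i C => submod_val z n) gb.
- by rewrite /E linearD linearZ_LR linearB => -> -> ->; rewrite subrr scaler0 addr0.
- by rewrite /E => aE; rewrite [LHS]tor_system_map aE; apply: local_homology_thread.
have [a aE] := local_homology_of_thread tt; exists a; apply: local_homology_ext => n.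
by rewrite -tE -aE.
Qed.

Lemma local_homology_connecting_exact i (a : local_homology m i A) : artinian C ->
  local_homology_map m i f a = 0 -> exists c, local_homology_connecting c a.
Proof.
move=> aC fa; pose E n (c : tor_system m i.+1 C n) := tor_connecting f g c (submod_val a n).
have [n|n|n u x y z|n c|t [tt tE]] := @affine_thread R (tor_system m i.+1 C) E.
- exact: tor_artinian.
- apply: (connecting_exact_left (se n)).
  by have := congr1 (fun z : local_homology m i B => submod_val z n) fa.
- move=> hx hy hz.
  have := connecting_lin u (connecting_lin (-1) hz hy) hx.
  by rewrite !scaleN1r addNr scaler0 add0r addrC [- z + y]addrC.
- move=> /tor_connecting_step.
  by rewrite (local_homology_thread a n).
have [c cE] := local_homology_of_thread tt; exists c => n.
by rewrite cE; apply: tE.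
Qed.

Lemma local_homology_connecting0 i (a : local_homology m i A) :
  local_homology_connecting 0 a -> a = 0.
Proof. by move=> ca; apply: local_homology_ext => n; apply: (connecting0 (se n)) (ca n). Qed.

Lemma local_homology_connectingZ i (u : R) c (a : local_homology m i A) :
  local_homology_connecting c a -> local_homology_connecting (u *: c) (u *: a).
Proof.
move=> ca n; have := connecting_lin (u - 1) (ca n) (ca n).
by rewrite !scalerBl !scale1r !subrK.
Qed.

End ShortExact.

Lemma local_homology_connecting_map i N1 N2 N3 N1' N2' N3'
    (f : {linear N1 -> N2}) (g : {linear N2 -> N3})
    (f' : {linear N1' -> N2'}) (g' : {linear N2' -> N3'})
    (p1 : {linear N1 -> N1'}) (p2 : {linear N2 -> N2'}) (p3 : {linear N3 -> N3'})
    (c : local_homology m i.+1 N3) (a : local_homology m i N1) :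
  (forall x, f' (p1 x) = p2 (f x)) -> (forall x, g' (p2 x) = p3 (g x)) ->
  local_homology_connecting f g c a ->
  local_homology_connecting f' g' (local_homology_map m i.+1 p3 c) (local_homology_map m i p1 a).
Proof.
move=> fp gp ca n.
exact: (@tor_connecting_map R (quot_exp m n) _ _ _ _ _ _ _ f g f' g' idfun p1 p2 p3
  _ _ _ fp gp (ca n)).
Qed.

End LocalHomologySequence.

Section DirectLimits.
Variables (R : comNzRingType) (X : dir_system R).

Lemma component_in n (x : X n) : component x n = x.
Proof. exact: dfwith_in. Qed.

Lemma component_out n (x : X n) k : n != k -> component x k = 0.
Proof. exact: dfwith_out. Qed.

Lemma component_linear n (a : R) (x y : X n) :
  component (a *: x + y) = a *: component x + component y.
Proof.
apply: functional_extensionality_dep => k.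
rewrite -[RHS]/(a *: component x k + component y k).
have [<-|nk] := eqVneq n k; first by rewrite !component_in.
by rewrite !component_out // scaler0 addr0.
Qed.

Fixpoint push n d : X n -> X (d + n)%N :=
  if d is k.+1 then fun x => dir_step X (k + n) (push k x) else id.

(** Adds up in X n the images of the components of index at most n. For large n the defining
    relations collapse to 0, so vanishing in the limit becomes visible at a finite stage. *)
Fixpoint collapse n (z : prodmod X) : X n :=
  if n is k.+1 then dir_step X k (collapse k z) + z k.+1 else z 0%N.

Lemma collapse_linear n (a : R) (z w : prodmod X) :
  collapse n (a *: z + w) = a *: collapse n z + collapse n w.
Proof. by elim: n => //= n ->; rewrite linearP scalerDr addrACA. Qed.

Lemma collapse_lt n t (x : X t) : (n < t)%N -> collapse n (component x) = 0.
Proof.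
elim: n => [|n IH] nt /=; first by rewrite component_out ?gtn_eqF.
by rewrite IH ?linear0 ?add0r ?component_out ?gtn_eqF // ltnW.
Qed.

Lemma collapse_push d t (x : X t) : collapse (d + t) (component x) = push d x.
Proof.
elim: d => [|d IH] /=; last first.
  by rewrite IH component_out ?addr0 // neq_ltn ltnS leq_addl.
case: t x => [|t] x /=; first exact: component_in.
by rewrite collapse_lt // linear0 add0r component_in.
Qed.

Lemma collapse_next d t (x : X t) :
  collapse (d + t.+1) (component x) = push d (dir_step X t x).
Proof.
elim: d => [|d IH] /=; last first.
  by rewrite IH component_out ?addr0 // neq_ltn ltnS (ltnW (leq_addl d t.+1)).
by rewrite [collapse t _](collapse_push 0) component_out ?addr0 // neq_ltn ltnSn.
Qed.

Lemma component_finite_support n (x : X n) :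
  component x \in mk_submod (@has_finite_support_submod R X).
Proof.
apply/mem_mk_submod; exists n.+1 => k nk.
by rewrite component_out // neq_ltn nk.
Qed.

Lemma dir_lim_classes : exists phi : forall n, {linear X n -> dir_lim X},
  [/\ forall z, exists n x, phi n x = z,
      forall n x, phi n.+1 (dir_step X n x) = phi n x
    & forall n x, phi n x = 0 -> exists d, push d x = 0].
Proof.
pose S := Defs.span (@dir_rel R X).
have cl n : linear (fun x : X n => Submod (component_finite_support x) : direct_sum X).
  by move=> a x y; apply: val_inj; apply: component_linear.
pose c n : {linear X n -> direct_sum X} :=
  HB.pack (fun x : X n => Submod (component_finite_support x) : direct_sum X)
    (GRing.isLinear.Build R (X n) (direct_sum X) *:%R _ (cl n)).
have cstep n x : c n x - c n.+1 (dir_step X n x) \in S.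
  by apply: mem_span; exists n, x.
exists (fun n => qproj S \o c n); split=> [z|n x|n x].
- have [{}z <-] := qproj_surj z.
  have /(mem_mk_submod (@has_finite_support_submod R X)) [k zk] := submodP z.
  pose tr n : prodmod X := fun j => if (j <= n)%N then submod_val z j else 0.
  have tr_fs n : tr n \in mk_submod (@has_finite_support_submod R X).
    apply/(mem_mk_submod (@has_finite_support_submod R X)).
    by rewrite /tr; exists n.+1 => j nj; rewrite leqNgt nj.
  (* Modulo the relations, the truncation of z at n equals the single component [collapse n z]; for
     n past the support this gives a representative of z. *)
  have trP n : (Submod (tr_fs n) : direct_sum X) - c n (collapse n (submod_val z)) \in S.
    elim: n => [|n IH].
      suff -> : Submod (tr_fs 0%N) = c 0%N (collapse 0 (submod_val z)) by rewrite subrr rpred0.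
      apply: val_inj; apply: functional_extensionality_dep => j; rewrite /= /tr.
      have [<-|j0] := eqVneq 0%N j; first by rewrite component_in.
      by rewrite component_out // leqn0 eq_sym (negbTE j0).
    have -> : (Submod (tr_fs n.+1) : direct_sum X) = Submod (tr_fs n) + c n.+1 (submod_val z n.+1).
      apply: val_inj; apply: functional_extensionality_dep => j.
      rewrite -[RHS]/(tr n j + component (submod_val z n.+1) j) /tr /=.
      have [<-|j0] := eqVneq n.+1 j; first by rewrite component_in leqnn ltnn add0r.
      by rewrite component_out // addr0 leq_eqVlt eq_sym (negbTE j0).
    rewrite -[collapse n.+1 _]/(dir_step X n (collapse n (submod_val z)) + submod_val z n.+1).
    rewrite linearD opprD addrACA subrr addr0.
    by have := rpredD IH (cstep n (collapse n (submod_val z))); rewrite addrA subrK.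
  exists k, (collapse k (submod_val z)); apply/esym/qproj_eq.
  suff e : Submod (tr_fs k) = z by have := trP k; rewrite e.
  apply: val_inj; apply: functional_extensionality_dep => j; rewrite /= /tr.
  by case: leqP => // /ltnW /zk /esym.
- by apply/esym/qproj_eq.
- move=> /qproj_eq0.
  pose P (z : direct_sum X) := exists k, forall n, (k <= n)%N -> collapse n (submod_val z) = 0.
  have Psub : is_submod P.
    split=> [|a u v [k hk] [l hl]].
      by exists 0%N => j _; elim: j => //= j ->; rewrite linear0 add0r.
    exists (maxn k l) => j; rewrite geq_max => /andP[kj lj].
    by apply: etrans (collapse_linear _ _ _ _) _; rewrite hk // hl // scaler0 addr0.
  move=> xS; have : c n x \in mk_submod Psub.
    move: (c n x) xS; apply: span_sub => z [t [y zE]]; apply/mem_mk_submod.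
    exists t.+1 => j tj; rewrite zE.
    have -> : component y - component (dir_step X t y) =
        -1 *: component (dir_step X t y) + component y by rewrite scaleN1r addrC.
    rewrite collapse_linear -(subnK tj) collapse_push collapse_next.
    by rewrite scaleN1r addNr.
  move=> /(mem_mk_submod Psub) [k hk]; exists k.
  by rewrite -collapse_push; apply: hk; rewrite leq_addr.
Qed.

End DirectLimits.

(** * Formal local homology *)

Section FormalLocalHomology.
Variables (R : comNzRingType) (m I : submodClosed R^o).
Hypotheses (nR : noetherian R^o) (m_max : maximal_ideal m).
Implicit Types M : lmodType R.

Let Ann M t : lmodType R := submod (ann_sub M (ideal_exp I t)).
Let H i M t : lmodType R := local_homology m i (Ann M t).

Lemma mem_ann M t (x : M) :
  x \in ann_sub M (ideal_exp I t) <-> forall a : R, a \in ideal_exp I t -> a *: x = 0.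
Proof. exact: (mem_mk_submod (killed_by_submod M (ideal_exp I t))). Qed.

Lemma ann_sub_le M t t' : (t <= t')%N ->
  {subset ann_sub M (ideal_exp I t) <= ann_sub M (ideal_exp I t')}.
Proof. by move=> tt' x /mem_ann hx; apply/mem_ann => a /(exp_le tt') /hx. Qed.

Lemma ann_submod M (T : submodClosed M) t (x : submod T) :
  x \in ann_sub (submod T) (ideal_exp I t) <-> submod_val x \in ann_sub M (ideal_exp I t).
Proof.
split=> /mem_ann hx; apply/mem_ann => a aI; last by apply: val_inj; exact: hx.
by rewrite -linearZ hx // linear0.
Qed.

Definition inclusion M t t' (j : {linear Ann M t -> Ann M t'}) :=
  forall x, submod_val (j x) = submod_val x.

Lemma inclusion_ex M t t' : (t <= t')%N -> exists j : {linear Ann M t -> Ann M t'}, inclusion j.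
Proof.
move=> tt'; have [|x|j jE] := @linear_factor R (Ann M t) (Ann M t') M
  (@submod_val R M _) (@submod_val R M _).
- exact: submod_val_inj.
- by exists (Submod (ann_sub_le tt' (submodP x))).
by exists j.
Qed.

(** The class of z in the direct limit is zero (see [formal_classes]). Any linear map with the
    values of the inclusion is accepted, whatever its construction. *)
Definition vanishes i M t (z : H i M t) := exists t' (j : {linear Ann M t -> Ann M t'}),
  inclusion j /\ local_homology_map m i j z = 0.

Lemma vanishes_large i M t (z : H i M t) : vanishes z -> exists d, forall t',
  (d <= t')%N -> forall j : {linear Ann M t -> Ann M t'}, inclusion j ->
  local_homology_map m i j z = 0.
Proof.
move=> [d [j [jE jz]]]; exists d => t' dt' j' j'E.
have [k kE] := inclusion_ex M dt'.
rewrite -(local_homology_map_comp (f := j) (g := k)) ?jz ?linear0 // => x.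
by apply: val_inj; rewrite [LHS]kE [LHS]jE [RHS]j'E.
Qed.

Lemma formal_classes i M :
  exists phi : forall t, {linear H i M t -> formal_local_homology m I i M},
  (forall z, exists t x, phi t x = z) /\ forall t x, phi t x = 0 <-> vanishes x.
Proof.
have [phi [phi_surj phi_step phi0]] := dir_lim_classes (formal_system m I i M).
have pushE t d : exists j : {linear Ann M t -> Ann M (d + t)}, inclusion j /\
    forall z : H i M t, @push R (formal_system m I i M) t d z = local_homology_map m i j z.
  elim: d => [|d [j [jE jP]]].
    by exists idfun; split=> // z; rewrite [RHS]local_homology_map_id.
  pose k := submap (@ann_sub_incr R M I (d + t)).
  exists (k \o j); split=> [x|z]; first by rewrite -[RHS]jE.
  rewrite -[LHS]/(local_homology_map m i k (@push R (formal_system m I i M) t d z)) jP.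
  exact: local_homology_map_comp.
exists phi; split=> // t x; split=> [/phi0 [d xd]|].
  by have [j [jE jP]] := pushE t d; exists (d + t)%N, j; split=> //; rewrite -jP.
move=> /vanishes_large [d hd]; have [j [jE jP]] := pushE t d.
have phi_push k : phi (k + t)%N (@push R (formal_system m I i M) t k x) = phi t x.
  elim: k => // k IH.
  exact: (etrans (phi_step (k + t)%N (@push R (formal_system m I i M) t k x)) IH).
by rewrite -(phi_push d) jP hd ?leq_addr // linear0.
Qed.

Definition formal_torsion i M := forall t (z : H i M t) (a : R), a \in m ->
  exists n, vanishes (a ^+ n *: z).

Definition formal_zero i M := forall t (z : H i M t), vanishes z.

Section StablePart.
Variables (M : lmodType R) (T : submodClosed M).
Hypotheses (aM : artinian M) (nT : noetherian (quotmod T)).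

(** C is the image of 0 :_M I^t in M/T, whose kernel is 0 :_T I^t. *)
Lemma stable_part_maps t : exists (C : lmodType R) (f : {linear Ann (submod T) t -> Ann M t})
    (g : {linear Ann M t -> C}),
  [/\ short_exact f g, noetherian C & forall x, submod_val (f x) = submod_val (submod_val x)].
Proof.
have [|x|f fE] := @linear_factor R (Ann (submod T) t) (Ann M t) M
  (@submod_val R M T \o @submod_val R _ _) (@submod_val R M _).
- exact: submod_val_inj.
- by exists (Submod (proj1 (ann_submod _ _) (submodP x))).
pose h : {linear Ann M t -> quotmod T} := qproj T \o @submod_val R M _.
have [g gE] := to_range h.
exists (submod (range h)), f, g; split=> //; last exact: noetherian_submod.
split.
- move=> x y fxy; apply: val_inj; apply: val_inj.
  by have := congr1 (@submod_val R M _) fxy; rewrite [LHS]fE [RHS]fE.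
- move=> c; have /mem_range [b hb] := submodP c; exists b; apply: val_inj.
  by rewrite [LHS]gE.
- move=> b; split=> [gb|[a <-]].
    have bT : submod_val b \in T.
      by apply/qproj_eq0; rewrite -[LHS]/(h b) -gE gb linear0.
    have bA : Submod bT \in ann_sub (submod T) (ideal_exp I t).
      exact: (proj2 (@ann_submod M T t (Submod bT)) (submodP b)).
    by exists (Submod bA); apply: val_inj; rewrite [LHS]fE.
  apply: val_inj; rewrite [LHS]gE /= fE; apply/qproj_eq0/submodP.
Qed.

(** Injectivity uses the vanishing of local homology of C in degree i+2, surjectivity its vanishing
    in degree i+1. *)
Lemma stable_part_iso i t (f : {linear Ann (submod T) t -> Ann M t}) :
  (forall x, submod_val (f x) = submod_val (submod_val x)) ->
  (forall w, local_homology_map m i.+1 f w = 0 -> w = 0) /\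
  (forall z, exists w, local_homology_map m i.+1 f w = z).
Proof.
move=> fE; have [C [f' [g [fg nC f'E]]]] := stable_part_maps t.
have ff w : local_homology_map m i.+1 f w = local_homology_map m i.+1 f' w.
  rewrite -(local_homology_map_comp (f := idfun) (g := f)); last by [].
  rewrite local_homology_map_id //.
  rewrite -(local_homology_map_comp (f := f) (g := idfun) (h := f')).
    by rewrite (local_homology_map_id (f := idfun)).
  by move=> x; apply: val_inj; rewrite [LHS]fE [RHS]f'E.
have [_ g_surj _] := fg.
have aA : artinian (Ann M t) by apply: artinian_submod.
split=> [w|z].
  rewrite ff => /(local_homology_connecting_exact nR m_max fg (artinian_surj g_surj aA)) [u uw].
  by move: uw; rewrite (local_homology_noetherian nR u nC) => /(local_homology_connecting0 fg).
have [||w <-] := local_homology_exact nR m_max fg (b := z); last by exists w.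
- by do 2!apply: artinian_submod.
- exact: local_homology_noetherian.
Qed.

Lemma stable_part_square t t' (f : {linear Ann (submod T) t -> Ann M t})
    (f' : {linear Ann (submod T) t' -> Ann M t'}) (j : {linear Ann M t -> Ann M t'})
    (k : {linear Ann (submod T) t -> Ann (submod T) t'}) i z :
  (forall x, submod_val (f x) = submod_val (submod_val x)) ->
  (forall x, submod_val (f' x) = submod_val (submod_val x)) ->
  inclusion j -> inclusion k ->
  local_homology_map m i f' (local_homology_map m i k z) =
  local_homology_map m i j (local_homology_map m i f z).
Proof.
move=> fE f'E jE kE; rewrite !(local_homology_map_comp (h := f' \o k)) //.
by move=> x; apply: val_inj; rewrite [LHS]jE [LHS]fE [RHS]f'E kE.
Qed.

Lemma stable_part_torsion i : formal_torsion i.+1 M -> formal_torsion i.+1 (submod T).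
Proof.
move=> tM t z a am; have [C [f [_ [_ _ fE]]]] := stable_part_maps t.
have [n /vanishes_large [d hd]] := tM t (local_homology_map m i.+1 f z) a am.
exists n; pose t' := maxn d t.
have [j jE] := inclusion_ex M (leq_maxr d t); have [k kE] := inclusion_ex (submod T) (leq_maxr d t).
exists t', k; split=> //.
have [C' [f' [_ [_ _ f'E]]]] := stable_part_maps t'.
have [f'_inj _] := stable_part_iso i f'E; apply: f'_inj.
by rewrite (stable_part_square _ fE f'E jE kE) linearZ hd ?leq_maxl.
Qed.

Lemma stable_part_zero i : formal_zero i.+1 (submod T) -> formal_zero i.+1 M.
Proof.
move=> zT t z; have [C [f [_ [_ _ fE]]]] := stable_part_maps t.
have [_ f_surj] := stable_part_iso i fE; have [w <-] := f_surj z.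
have [d hd] := vanishes_large (zT t w); pose t' := maxn d t.
have [j jE] := inclusion_ex M (leq_maxr d t); have [k kE] := inclusion_ex (submod T) (leq_maxr d t).
have [C' [f' [_ [_ _ f'E]]]] := stable_part_maps t'.
exists t', j; split=> //.
by rewrite -(stable_part_square _ fE f'E jE kE) hd ?leq_maxl ?linear0.
Qed.

End StablePart.

(** * The case x M = M: passage to the kernel of x *)

Section StableElement.
Variables (M : lmodType R) (x : R).
Hypotheses (aM : artinian M) (xm : x \in m) (x_surj : forall y : M, exists z, x *: z = y).

Let L : submodClosed M := mk_submod (ker_submod (scalemap M x)).
Let h t : {linear Ann M t -> M} := scalemap M x \o @submod_val R M _.
Let C t : lmodType R := submod (range (h t)).

Let f_ex t : exists f : {linear Ann (submod L) t -> Ann M t},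
  forall y, submod_val (f y) = submod_val (submod_val y).
Proof.
have [|y|f fE] := @linear_factor R (Ann (submod L) t) (Ann M t) M
  (@submod_val R M L \o @submod_val R _ _) (@submod_val R M _).
- exact: submod_val_inj.
- by exists (Submod (proj1 (ann_submod _ _) (submodP y))).
by exists f.
Qed.
Let f t := sval (cid (f_ex t)).
Let fE t y : submod_val (f t y) = submod_val (submod_val y) := svalP (cid (f_ex t)) y.

Let g t := sval (cid (to_range (h t))).
Let gE t y : submod_val (g t y) = x *: submod_val y := svalP (cid (to_range (h t))) y.

Let memL y : y \in L <-> x *: y = 0 := mem_mk_submod (ker_submod (scalemap M x)) y.

Let fg t : short_exact (f t) (g t).
Proof.
split.
- move=> y z fyz; apply: val_inj; apply: val_inj.
  by have := congr1 (@submod_val R M _) fyz; rewrite [LHS]fE [RHS]fE.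
- move=> c; have /mem_range [b hb] := submodP c; exists b; apply: val_inj.
  by rewrite [LHS]gE.
- move=> b; split=> [gb|[a <-]].
    have bT : submod_val b \in L by apply/memL; rewrite -gE gb linear0.
    have bA : Submod bT \in ann_sub (submod L) (ideal_exp I t).
      exact: (proj2 (@ann_submod M L t (Submod bT)) (submodP b)).
    by exists (Submod bA); apply: val_inj; rewrite [LHS]fE.
  by apply: val_inj; rewrite [LHS]gE fE; apply/memL/submodP.
Qed.

Let artC t : artinian (C t). Proof. exact: artinian_submod. Qed.
Let artL t : artinian (Ann (submod L) t). Proof. by do 2!apply: artinian_submod. Qed.

Let c_ex t : exists c : {linear C t -> Ann M t}, forall y, submod_val (c y) = submod_val y.
Proof.
have [|y|c cE] := @linear_factor R (C t) (Ann M t) M (@submod_val R M _) (@submod_val R M _).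
- exact: submod_val_inj.
- have /mem_range [b hb] := submodP y.
  have yA : submod_val y \in ann_sub M (ideal_exp I t).
    by rewrite -hb; apply: rpredZ; apply: submodP.
  by exists (Submod yA).
by exists c.
Qed.

(** With [c_ex], this interleaves the systems x (0 :_M I^t) and 0 :_M I^t, which therefore have the
    same direct limit. *)
Let e_ex t : exists2 t', (t <= t')%N &
  exists e : {linear Ann M t -> C t'}, forall y, submod_val (e y) = submod_val y.
Proof.
have [t' ht'] := artin_rees_dual I t nR aM x_surj.
exists (maxn t' t); first exact: leq_maxr.
have [|y|e eE] := @linear_factor R (Ann M t) (C (maxn t' t)) M
  (@submod_val R M _) (@submod_val R M _).
- exact: submod_val_inj.
- have [z zA xz] := ht' _ (submodP y).
  have yR : submod_val y \in range (h (maxn t' t)).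
    by apply/mem_range; exists (Submod (ann_sub_le (leq_maxl t' t) zA)).
  by exists (Submod yR).
by exists e.
Qed.

Let f_square t t' (j : {linear Ann M t -> Ann M t'})
    (k : {linear Ann (submod L) t -> Ann (submod L) t'}) :
  inclusion j -> inclusion k -> forall y, f t' (k y) = j (f t y).
Proof. by move=> jE kE y; apply: val_inj; rewrite [LHS]fE [RHS]jE [RHS]fE kE. Qed.

(** Torsion in degree i makes a^n z die in M, so at a later stage it comes from a class u in degree
    i+1 of the third term C. Torsion in degree i+1, transported by the interleaving, kills a^p u,
    hence a^(p+n) z. *)
Lemma kernel_torsion i : formal_torsion i.+1 M -> formal_torsion i M ->
  formal_torsion i (submod L).
Proof.
move=> tM1 tM t z a am.
have [n /vanishes_large [d1 hd1]] := tM t (local_homology_map m i (f t) z) a am.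
pose t1 := maxn d1 t; have tt1 : (t <= t1)%N := leq_maxr d1 t.
have [j jE] := inclusion_ex M tt1; have [k kE] := inclusion_ex (submod L) tt1.
pose w := local_homology_map m i k (a ^+ n *: z).
have fw : local_homology_map m i (f t1) w = 0.
  rewrite (local_homology_map_comp (h := j \o f t) _ (f_square jE kE)).
  rewrite -(local_homology_map_comp (f := f t) (g := j)) // linearZ.
  by rewrite hd1 // leq_maxl.
have [u uw] := local_homology_connecting_exact nR m_max (fg t1) (@artC t1) fw.
have [c cE] := c_ex t1.
have [p /vanishes_large [d2 hd2]] := tM1 t1 (local_homology_map m i.+1 c u) a am.
pose t2 := maxn d2 t1; have t12 : (t1 <= t2)%N := leq_maxr d2 t1.
have [j2 j2E] := inclusion_ex M t12.
have [t3 t23 [e eE]] := e_ex t2.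
have t13 := leq_trans t12 t23.
have [j3 j3E] := inclusion_ex M t13; have [k3 k3E] := inclusion_ex (submod L) t13.
(* The transition C t1 -> C t3 is factored through the annihilators at t1 and t2, where a^p u is
   known to vanish. *)
have gj y : g t3 (j3 y) = (e \o j2 \o c) (g t1 y).
  by apply: val_inj; rewrite [LHS]gE j3E [RHS]eE [RHS]j2E [RHS]cE gE.
have := local_homology_connecting_map (f_square j3E k3E) gj
  (local_homology_connectingZ (a ^+ p) uw).
have -> : local_homology_map m i.+1 (e \o j2 \o c) (a ^+ p *: u) = 0.
  rewrite -(local_homology_map_comp (f := c) (g := e \o j2)) //.
  rewrite -(local_homology_map_comp (f := j2) (g := e)) // linearZ.
  by rewrite hd2 ?linear0 ?leq_maxl.
move=> /(local_homology_connecting0 (fg t3)); rewrite /w -linearZ scalerA -exprD => w0.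
exists (p + n)%N, t3, (k3 \o k); split=> [y|]; first by rewrite [LHS]k3E kE.
by rewrite -(local_homology_map_comp (f := k) (g := k3)).
Qed.

(** Vanishing for L makes multiplication by x injective in the limit; by torsion some x^n kills z,
    and the factors x are cancelled one by one. *)
Lemma kernel_zero i : formal_zero i (submod L) -> formal_torsion i M -> formal_zero i M.
Proof.
move=> zL tM t z.
have inj_x (w : H i M t) : vanishes (x *: w) -> vanishes w.
  move=> /vanishes_large [d1 hd1].
  pose t1 := maxn d1 t; have tt1 : (t <= t1)%N := leq_maxr d1 t.
  have [j1 j1E] := inclusion_ex M tt1.
  pose w1 := local_homology_map m i j1 w.
  have xw1 : x *: w1 = 0 by rewrite -linearZ; apply: hd1; rewrite ?leq_maxl.
  have [c cE] := c_ex t1; have [t2 t12 [e eE]] := e_ex t1.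
  have [j2 j2E] := inclusion_ex M t12.
  have gw : local_homology_map m i (g t2) (local_homology_map m i j2 w1) = 0.
    (* After enlarging the stage, g is multiplication by x on 0 :_M I^t1, which is [c \o g t1],
       followed by the embedding e. *)
    rewrite (local_homology_map_comp (h := e \o (c \o g t1))); last first.
      by move=> y; apply: val_inj; rewrite [LHS]gE j2E [RHS]eE [RHS]cE gE.
    rewrite -(local_homology_map_comp (f := c \o g t1) (g := e)) //.
    rewrite (@local_homology_map_scale _ _ _ _ (c \o g t1) x) ?xw1 ?linear0 // => y.
    by apply: val_inj; rewrite [LHS]cE gE.
  have [v vE] := local_homology_exact nR m_max (fg t2) (@artL t2) gw.
  have [d3 hd3] := vanishes_large (zL t2 v).
  have [j3 j3E] := inclusion_ex M (leq_maxr d3 t2).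
  have [k3 k3E] := inclusion_ex (submod L) (leq_maxr d3 t2).
  exists (maxn d3 t2), (j3 \o (j2 \o j1)); split=> [y|].
    by rewrite [LHS]j3E [LHS]j2E j1E.
  rewrite -(local_homology_map_comp (f := j2 \o j1) (g := j3)) //.
  rewrite -(local_homology_map_comp (f := j1) (g := j2)) // -/w1 -vE.
  rewrite (local_homology_map_comp (h := f _ \o k3)); last first.
    by move=> y; rewrite -(f_square j3E k3E).
  rewrite -(local_homology_map_comp (f := k3) (g := f _)) //.
  by rewrite hd3 ?leq_maxl ?linear0.
have [n] := tM t z x xm; elim: n => [|n IH]; first by rewrite scale1r.
by rewrite exprS -scalerA => /inj_x.
Qed.

End StableElement.

Lemma formal_zero_trivial i M : (forall y : M, y = 0) -> formal_zero i.+1 M.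
Proof.
move=> M0 t z; exists t, idfun; split=> //.
rewrite (@local_homology_noetherian _ _ nR _ _ z) ?linear0 //.
by apply/noetherian_submod/noetherian_trivial.
Qed.

Lemma formal_zero_of_torsion s M : artinian M ->
  (forall i, (s < i)%N -> formal_torsion i M) -> forall i, (s < i)%N -> formal_zero i M.
Proof.
move: M; apply: artinian_ind => M aM IH tM.
have [T [k [x [nT _ xm xT]]]] := artinian_stable_part nR m_max aM.
have [prop|full] := EM (exists v, v \notin T).
  (* A degree above s is positive, which is what the comparison of T with M requires. *)
  case=> // i si; apply: (stable_part_zero aM nT); apply: IH => // -[//|j] sj.
  exact/(stable_part_torsion aM nT)/tM.
have {xT full} x_surj (y : M) : exists z, x *: z = y.
  have [|z _ <-] := xT y; last by exists z.
  by apply: contrapT => /negP yT; apply: full; exists y.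
pose L := mk_submod (ker_submod (scalemap M x)).
have [prop|full] := EM (exists v, v \notin L).
  move=> i si; apply: (kernel_zero aM xm x_surj); last exact: tM.
  apply: IH => // j sj; apply: (kernel_torsion aM x_surj); apply: tM => //.
  exact: leqW.
(* Here x kills M while x M = M, so M = 0. *)
case=> // i _; apply: formal_zero_trivial => y; have [z <-] := x_surj y.
apply/(mem_mk_submod (ker_submod (scalemap M x))).
by apply: contrapT => /negP zL; apply: full; exists z.
Qed.

Lemma formal_eq0_of_ass s M : artinian M ->
  (forall i, (s < i)%N -> forall p, ass (formal_local_homology m I i M) p -> p =i m) ->
  forall i, (s < i)%N -> forall z : formal_local_homology m I i M, z = 0.
Proof.
move=> aM assM i si z; have [phi [phi_surj phi0]] := formal_classes i M.
have [t [y <-]] := phi_surj z; apply/phi0.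
apply: (formal_zero_of_torsion aM _ si) => {i si z t y phi phi_surj phi0} i si t z a am.
have [phi [_ phi0]] := formal_classes i M.
have [n zn] := torsion_of_ass nR (assM i si) (phi t z) am.
by exists n; apply/phi0; rewrite linearZ.
Qed.

End FormalLocalHomology.

Theorem theorem3p7 (R : comNzRingType) (m I : submodClosed R^o)
    (M : lmodType R) (s : nat) :
  noetherian R^o -> local_ring m -> artinian M ->
  ((forall i, (s < i)%N -> artinian (formal_local_homology m I i M)) <->
   (forall i, (s < i)%N ->
      forall x : formal_local_homology m I i M, x = 0)) /\
  ((forall i, (s < i)%N ->
      forall x : formal_local_homology m I i M, x = 0) <->
   (forall i, (s < i)%N ->
      forall p : submodClosed R^o,
        ass (formal_local_homology m I i M) p -> p =i m)).
Proof.
move=> nR m_local aM; have eq0 := formal_eq0_of_ass nR (proj1 m_local) (I := I) (s := s) aM.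
split; split=> [hM|hM].
- by apply: eq0 => i si p; apply: ass_of_artinian m_local (hM i si).
- by move=> i si; apply: artinian_trivial; apply: hM.
- move=> i si p [[/negP p1 _] [x px]]; case: p1; apply/px.
  by rewrite scale1r; apply: hM.
- exact: eq0.
Qed.
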